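(* Let $\mathcal N$ be the Cohen symmetric model with countable supports over $V\models\mathsf{ZFC}$, let $A$ be its canonical set of Cohen reals, and let $S=(A^\omega)^{\mathcal N}$. Let $M$ be a transitive model of $\mathsf{ZF}$ with $S\in M$. If $M\models\mathsf{PP}^{\mathrm{split}}\!\restriction\mathcal P(S)$, then $S$ is well-orderable in $M$. Consequently, if $M\models\mathsf{PP}^{\mathrm{split}}\!\restriction\mathcal P(S)$ and $M\models\mathsf{SVC}(S)$, then $M\models\mathsf{AC}$.
   Context: $\mathsf{PP}^{\mathrm{split}}\!\restriction\mathcal P(S)$ (in $M$) is the assertion: for all $X,Y\subseteq\mathcal P(S)^M$ in $M$ and every surjection $f:Y\twoheadrightarrow X$ in $M$, there is in $M$ a right inverse $s:X\to Y$ with $f\circ s=\mathrm{id}_X$. Here $\mathcal P(S)^M$ is the powerset of $S$ computed in $M$. $\mathsf{SVC}(S)$ is the statement: for every set $X$ there are an ordinal $\eta$ and a surjection $S\times\eta\twoheadrightarrow X$. The model $\mathcal N$: let $\mathbb P=\mathrm{Add}(\omega,\omega_1)$ be the set of finite partial functions from $\omega_1\times\omega$ to $2$ ordered by reverse inclusion, and $G_0\subseteq\mathbb P$ be $V$-generic. $\mathcal G=\mathrm{Sym}(\omega_1)$ acts on $\mathbb P$ by $(\pi p)(\pi(\alpha),n)=p(\alpha,n)$ and on names by $\pi\dot x=\{\langle\pi\dot y,\pi p\rangle:\langle\dot y,p\rangle\in\dot x\}$. $\mathcal F$ is the normal filter of subgroups of $\mathcal G$ generated by the pointwise stabilizers $\mathrm{Fix}(E)$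 of countable $E\subseteq\omega_1$ ($E\in V$, countable in $V$). A name is hereditarily symmetric (in $\mathrm{HS}$) if its stabilizer in $\mathcal G$ belongs to $\mathcal F$ and all names appearing in it are in $\mathrm{HS}$; $\mathcal N=\{\dot x^{G_0}:\dot x\in\mathrm{HS}\}$. $A=\{c_\alpha:\alpha<\omega_1\}\in\mathcal N$, where $c_\alpha=\{n:\exists p\in G_0\ p(\alpha,n)=1\}$, identified with an element of $2^\omega$. $(A^\omega)^{\mathcal N}$ is the set of all functions $\omega\to A$ belonging to $\mathcal N$; $S$ is this fixed set and is not reinterpreted in $M$. *)

(* Defs.v *)
From Stdlib Require List.

Set Implicit Arguments.
Unset Strict Implicit.
Unset Printing Implicit Defensive.

(** The ambient universe: a well-founded extensional structure satisfying
    second-order ZF, for example Aczel's iterative sets modulo bisimulation.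
    The ground model [V], the generic filter and the model [M] all live in it.
    [V] and [M] are arbitrary transitive subclasses, so set models (in
    particular countable ones) are included. *)
Record Universe := {
  set :> Type;
  mem : set -> set -> Prop;
  mem_ext : forall x y, (forall z, mem z x <-> mem z y) -> x = y;
  mem_wf : well_founded mem;
  upair : set -> set -> set;
  upairP : forall x y z, mem z (upair x y) <-> z = x \/ z = y;
  bigcup : set -> set;
  bigcupP : forall x z, mem z (bigcup x) <-> exists y, mem y x /\ mem z y;
  power : set -> set;
  powerP : forall x z, mem z (power x) <-> forall w, mem w z -> mem w x;
  sep : set -> (set -> Prop) -> set;
  sepP : forall x P z, mem z (sep x P) <-> mem z x /\ P z;
  repl : set -> (set -> set) -> set;
  replP : forall x F z, mem z (repl x F) <-> exists y, mem y x /\ z = F y;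
  infty : set;
  infty0 : exists e, mem e infty /\ forall z, ~ mem z e;
  inftyS : forall x, mem x infty ->
    exists y, mem y infty /\ forall z, mem z y <-> mem z x \/ z = x
}.

Declare Scope uset_scope.
Open Scope uset_scope.
Notation "x ∈ y" := (mem x y) (at level 70) : uset_scope.

Definition subset {U : Universe} (x y : U) : Prop := forall z, z ∈ x -> z ∈ y.
Notation "x ⊆ y" := (subset x y) (at level 70) : uset_scope.

(** Kuratowski pairs. *)
Definition opair {U : Universe} (x y : U) : U := upair (upair x x) (upair x y).
Notation "⟨ x , y ⟩" := (opair x y) (at level 0, format "⟨ x ,  y ⟩") : uset_scope.

Section Basics.
Context {U : Universe}.
Implicit Types (x y z a b f R : U) (C : U -> Prop).

Definition empty : U := sep (infty U) (fun _ => False).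
Definition cup x y : U := bigcup (upair x y).
Definition succ x : U := cup x (upair x x).

Definition inductive_set x : Prop :=
  empty ∈ x /\ forall n, n ∈ x -> succ n ∈ x.
Definition omega : U :=
  sep (infty U) (fun n => forall x, inductive_set x -> n ∈ x).

Definition prod a b : U :=
  sep (power (power (cup a b)))
      (fun z => exists x y, x ∈ a /\ y ∈ b /\ z = ⟨x, y⟩).

Definition finite x : Prop := exists l : list U, forall z, z ∈ x <-> List.In z l.

Definition transitive_set x : Prop := forall y, y ∈ x -> y ⊆ x.

(** Well-ordering by membership reduces to trichotomy, membership being
    well-founded. *)
Definition ordinal x : Prop :=
  transitive_set x /\
  forall y z, y ∈ x -> z ∈ x -> y ∈ z \/ y = z \/ z ∈ y.

Definition is_fun f a b : Prop :=
  f ⊆ prod a b /\ forall x, x ∈ a -> exists! y, ⟨x, y⟩ ∈ f.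

(** The value of [f] at [x], as the union of the singleton it forms. *)
Definition app f x : U :=
  bigcup (sep (bigcup (bigcup f)) (fun y => ⟨x, y⟩ ∈ f)).

Definition injection f a b : Prop :=
  is_fun f a b /\
  forall x y, x ∈ a -> y ∈ a -> app f x = app f y -> x = y.

Definition surjection f a b : Prop :=
  is_fun f a b /\ forall y, y ∈ b -> exists x, x ∈ a /\ app f x = y.

Definition bijection f a b : Prop := injection f a b /\ surjection f a b.

Definition transitive_class C : Prop := forall x y, C x -> y ∈ x -> C y.

End Basics.

(** First-order formulas of set theory, with de Bruijn indices. *)
Inductive formula : Type :=
| fMem (i j : nat)
| fEq (i j : nat)
| fFalse
| fImp (p q : formula)
| fAll (p : formula).

Definition scons {T : Type} (x : T) (e : nat -> T) (n : nat) : T :=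
  match n with O => x | S m => e m end.

(** Satisfaction in the structure whose domain is the class [C]. *)
Fixpoint sat {U : Universe} (C : U -> Prop) (e : nat -> U) (p : formula) : Prop :=
  match p with
  | fMem i j => e i ∈ e j
  | fEq i j => e i = e j
  | fFalse => False
  | fImp p q => sat C e p -> sat C e q
  | fAll p => forall x, C x -> sat C (scons x e) p
  end.

Section Models.
Context {U : Universe} (C : U -> Prop).
Implicit Types (x y z w a b f X Y S R : U) (e : nat -> U).

(** The axioms of ZF relativized to [C]; separation and replacement are the
    first-order schemes, with parameters from [C]. *)
Record ZF : Prop := {
  zf_ext : forall x y, C x -> C y ->
    (forall z, C z -> (z ∈ x <-> z ∈ y)) -> x = y;
  zf_found : forall x, C x -> (exists y, C y /\ y ∈ x) ->
    exists y, C y /\ y ∈ x /\ forall z, C z -> ~ (z ∈ x /\ z ∈ y);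
  zf_pair : forall x y, C x -> C y ->
    exists z, C z /\ forall w, C w -> (w ∈ z <-> w = x \/ w = y);
  zf_union : forall x, C x ->
    exists z, C z /\ forall w, C w -> (w ∈ z <-> exists y, C y /\ y ∈ x /\ w ∈ y);
  zf_power : forall x, C x ->
    exists z, C z /\
      forall w, C w -> (w ∈ z <-> forall y, C y -> y ∈ w -> y ∈ x);
  zf_infinity : exists x, C x /\
    (exists y, C y /\ y ∈ x /\ forall z, C z -> ~ z ∈ y) /\
    (forall y, C y -> y ∈ x ->
      exists z, C z /\ z ∈ x /\ forall w, C w -> (w ∈ z <-> w ∈ y \/ w = y));
  zf_sep : forall (p : formula) e a, (forall i, C (e i)) -> C a ->
    exists b, C b /\
      forall x, C x -> (x ∈ b <-> x ∈ a /\ sat C (scons x e) p);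
  zf_repl : forall (p : formula) e a, (forall i, C (e i)) -> C a ->
    (forall x, C x -> x ∈ a ->
      exists! y, C y /\ sat C (scons x (scons y e)) p) ->
    exists b, C b /\ forall y, C y ->
      (y ∈ b <-> exists x, C x /\ x ∈ a /\ sat C (scons x (scons y e)) p)
}.

(** In this part [C] is meant to be a transitive model of ZF.  Pairs, products,
    functions, values, surjections and ordinals are absolute for such [C], so
    only the quantifiers over sets are relativized. *)

Definition AC : Prop :=
  forall X, C X -> (forall x, x ∈ X -> x <> empty) ->
    exists f, C f /\ is_fun f X (bigcup X) /\ forall x, x ∈ X -> app f x ∈ x.

Definition countable_in a : Prop := exists f, C f /\ injection f a omega.

Definition is_omega1 a : Prop :=
  C a /\ ordinal a /\ ~ countable_in a /\ forall x, x ∈ a -> countable_in x.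

Definition powerset_in S x : Prop := C x /\ x ⊆ S.

Definition PPsplit S : Prop :=
  forall X Y f, C X -> C Y -> C f ->
    (forall x, x ∈ X -> powerset_in S x) ->
    (forall y, y ∈ Y -> powerset_in S y) ->
    surjection f Y X ->
    exists s, C s /\ is_fun s X Y /\ forall x, x ∈ X -> app f (app s x) = x.

Definition SVC S : Prop :=
  forall X, C X ->
    exists eta f, C eta /\ ordinal eta /\ C f /\ surjection f (prod S eta) X.

Definition well_orders_in R S : Prop :=
  (forall x, x ∈ S -> ~ ⟨x, x⟩ ∈ R) /\
  (forall x y z, x ∈ S -> y ∈ S -> z ∈ S ->
     ⟨x, y⟩ ∈ R -> ⟨y, z⟩ ∈ R -> ⟨x, z⟩ ∈ R) /\
  (forall x y, x ∈ S -> y ∈ S -> ⟨x, y⟩ ∈ R \/ x = y \/ ⟨y, x⟩ ∈ R) /\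
  (forall X, C X -> X ⊆ S -> X <> empty ->
     exists x, x ∈ X /\ forall y, y ∈ X -> x = y \/ ⟨x, y⟩ ∈ R).

Definition well_orderable_in S : Prop := exists R, C R /\ well_orders_in R S.

End Models.

(** The Cohen symmetric model over [V]; [w1] is the first uncountable ordinal
    of [V]. *)
Section Cohen.
Context {U : Universe} (V : U -> Prop) (w1 : U).
Implicit Types (x y z p q r pi rho sigma E D G : U) (H K : U -> Prop).

(** Conditions of Add(omega, w1); [q] is stronger than [p] when [p ⊆ q]. *)
Definition cond p : Prop :=
  V p /\ finite p /\ p ⊆ prod (prod w1 omega) (upair empty (succ empty)) /\
  forall x i j, ⟨x, i⟩ ∈ p -> ⟨x, j⟩ ∈ p -> i = j.

Definition generic G : Prop :=
  (forall p, p ∈ G -> cond p) /\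
  (exists p, p ∈ G) /\
  (forall p q, cond p -> q ∈ G -> p ⊆ q -> p ∈ G) /\
  (forall p q, p ∈ G -> q ∈ G -> exists r, r ∈ G /\ p ⊆ r /\ q ⊆ r) /\
  (forall D, V D -> (forall p, p ∈ D -> cond p) ->
     (forall p, cond p -> exists q, q ∈ D /\ p ⊆ q) ->
     exists p, p ∈ G /\ p ∈ D).

(** The group of permutations of [w1] in [V]; permutations are sets, while
    subgroups are represented by predicates on permutations.  The only filter
    membership used below is that of stabilizers of names in [V], which are
    definable in [V]; so predicates not represented in [V] add nothing. *)
Definition perm pi : Prop := V pi /\ bijection pi w1 w1.

Definition perm_id : U :=
  sep (prod w1 w1) (fun z => exists a, z = ⟨a, a⟩).
Definition perm_comp pi rho : U :=
  sep (prod w1 w1) (fun z => exists a, z = ⟨a, app pi (app rho a)⟩).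
Definition perm_inv pi : U :=
  sep (prod w1 w1) (fun z => exists a b, z = ⟨b, a⟩ /\ ⟨a, b⟩ ∈ pi).

Definition subgroup H : Prop :=
  (forall pi, H pi -> perm pi) /\
  H perm_id /\
  (forall pi rho, H pi -> H rho -> H (perm_comp pi rho)) /\
  (forall pi, H pi -> H (perm_inv pi)).

Definition pointwise_stab E : U -> Prop :=
  fun pi => perm pi /\ forall a, a ∈ E -> app pi a = a.

Inductive in_filter : (U -> Prop) -> Prop :=
| filter_fix E : V E -> E ⊆ w1 -> countable_in V E -> in_filter (pointwise_stab E)
| filter_up H K : in_filter H -> subgroup K -> (forall pi, H pi -> K pi) ->
    in_filter K
| filter_cap H K : in_filter H -> in_filter K ->
    in_filter (fun pi => H pi /\ K pi)
| filter_conj H pi : in_filter H -> perm pi ->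
    in_filter (fun rho => exists sigma,
      H sigma /\ rho = perm_comp (perm_comp pi sigma) (perm_inv pi)).

(** [q] is the image of the condition [p] under [pi]. *)
Definition act_cond pi p q : Prop :=
  forall z, z ∈ q <->
    exists a n i, ⟨⟨a, n⟩, i⟩ ∈ p /\ z = ⟨⟨app pi a, n⟩, i⟩.

(** [act_name pi x x'] is the graph of the recursion
    [pi x = {⟨pi y, pi p⟩ : ⟨y, p⟩ ∈ x}]; the two premises are the two
    inclusions. *)
Inductive act_name pi : U -> U -> Prop :=
| act_name_intro x x' :
    (forall y p, ⟨y, p⟩ ∈ x ->
       exists y' p', act_name pi y y' /\ act_cond pi p p' /\ ⟨y', p'⟩ ∈ x') ->
    (forall z, z ∈ x' ->
       exists y p y' p', ⟨y, p⟩ ∈ x /\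
         act_name pi y y' /\ act_cond pi p p' /\ z = ⟨y', p'⟩) ->
    act_name pi x x'.

Definition stabilizer x : U -> Prop := fun pi => perm pi /\ act_name pi x x.

(** Hereditarily symmetric names. *)
Inductive HS : U -> Prop :=
| HS_intro x : V x ->
    (forall z, z ∈ x -> exists y p, z = ⟨y, p⟩ /\ cond p /\ HS y) ->
    in_filter (stabilizer x) ->
    HS x.

(** [evaluates G x v] is the graph of the recursion
    [x^G = {y^G : ⟨y, p⟩ ∈ x, p ∈ G}], again given by the two inclusions. *)
Inductive evaluates G : U -> U -> Prop :=
| evaluates_intro x v :
    (forall y p, ⟨y, p⟩ ∈ x -> p ∈ G -> exists w, w ∈ v /\ evaluates G y w) ->
    (forall w, w ∈ v ->
       exists y p, ⟨y, p⟩ ∈ x /\ p ∈ G /\ evaluates G y w) ->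
    evaluates G x v.

Definition symmetric_model G : U -> Prop :=
  fun v => exists x, HS x /\ evaluates G x v.

Definition cohen_real G (a : U) : U :=
  sep omega (fun n => exists p, p ∈ G /\ ⟨⟨a, n⟩, succ empty⟩ ∈ p).

Definition cohen_set G : U := repl w1 (cohen_real G).

(** The functions from [omega] to [cohen_set G] that belong to the symmetric
    model. *)
Definition cohen_sequences G : U :=
  sep (power (prod omega (cohen_set G)))
      (fun f => is_fun f omega (cohen_set G) /\ symmetric_model G f).

End Cohen.

(* Main.v *)
Require Import Defs.
From Stdlib Require Import Classical.

Set Implicit Arguments.
Unset Strict Implicit.

(** It suffices to find in [M] a choice function on the nonempty subsets of [S],
    since Zermelo's theorem then well-orders [S].  A choice function is a
    splitting of the projection of [{(x, a) : a ∈ x ⊆ S}] to its first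
    coordinate, so it suffices to code such pairs by subsets of [S].

    An element of [S] is a subset of [⋃ S], hence [a] is a subset of [ω × A].
    If [A] has two elements [d <> e], then [S] contains, for [b ∈ A] and
    [n + 1 < m], the sequence that is [b] at 0, [e] strictly between [n] and [m],
    and [d] elsewhere.  The sequences with [m = n + 2] form a copy of [ω × A], and
    they are freed by mapping [(n, m, b)] to [(n, m + 1, b)].  So a subset of [S]
    can store [x] and [a] side by side.  If [A] has at most one element, so has [S].

    The sequences used have names that are fixed by every permutation fixing
    three points of [ω1]; neither the forcing theorem nor a dense set is needed. *)

(** * Sets, pairs, functions and natural numbers *)

(** A splitting is granted only for families of subsets of [S], and a pair (x, a) is not such a
    subset; this is why a coding is needed at all. The codes must be read inside [M], where only [S]
    is given: the decoding relations are defined from [S] and two reals [d], [e], which lie in [M]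
    as values of members of [S]. Encoding takes full preimages, so that no code is ever chosen.

    In a block, [n] is the place just before the run of [e] and [m] the first place after it. The
    condition n + 1 < m makes the run nonempty, for otherwise (n, m) could not be read off. Place 0
    is kept out of the run so that it can hold any [b], even one equal to [d] or [e].

    Transitive models satisfy the first-order schemes only, so membership of a set in [M] or [V] is
    obtained by defining it from parameters. In particular the canonical names of all natural
    numbers must form one function in [V] before a name of a sequence can be written down. *)

Section Basic.
Context {U : Universe}.
Implicit Types x y z a b f : U.

Lemma mem_induction (P : U -> Prop) :
  (forall x, (forall y, y ∈ x -> P y) -> P x) -> forall x, P x.
Proof. intros H x; induction (mem_wf x) as [x _ IH]; auto. Qed.

Lemma mem_irrefl x : ~ x ∈ x.
Proof. induction x as [x IH] using mem_induction; intros H; exact (IH x H H). Qed.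

Lemma mem_asym x y : x ∈ y -> ~ y ∈ x.
Proof.
  revert y; induction x as [x IH] using mem_induction; intros y H1 H2.
  exact (IH y H2 x H2 H1).
Qed.

Lemma mem_minimal (P : U -> Prop) x :
  P x -> exists y, P y /\ forall z, z ∈ y -> ~ P z.
Proof.
  induction x as [x IH] using mem_induction; intros Hx.
  destruct (classic (exists y, y ∈ x /\ P y)) as [[y [H1 H2]]|H]; [eauto|].
  exists x; split; [exact Hx|]; intros z Hz Pz; apply H; eauto.
Qed.

Lemma subset_antisym x y : x ⊆ y -> y ⊆ x -> x = y.
Proof. intros H1 H2; apply mem_ext; split; auto. Qed.

Lemma emptyP z : ~ z ∈ (empty : U).
Proof. intros H; apply sepP in H; tauto. Qed.

Lemma nonemptyP x : x <> empty <-> exists y, y ∈ x.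
Proof.
  split.
  - intros H; apply NNPP; intros H'; apply H; apply mem_ext; intros z; split; intros Hz.
    + exfalso; eauto.
    + destruct (emptyP Hz).
  - intros [y Hy] ->; exact (emptyP Hy).
Qed.

Lemma cupP x y z : z ∈ cup x y <-> z ∈ x \/ z ∈ y.
Proof.
  unfold cup; rewrite bigcupP; split.
  - intros [w [H1 H2]]; apply upairP in H1; destruct H1; subst; auto.
  - intros [H|H]; [exists x|exists y]; rewrite upairP; auto.
Qed.

Lemma singP x z : z ∈ upair x x <-> z = x.
Proof. rewrite upairP; tauto. Qed.

Lemma succP x z : z ∈ succ x <-> z ∈ x \/ z = x.
Proof. unfold succ; rewrite cupP, singP; tauto. Qed.

Lemma mem_succ x : x ∈ succ x.
Proof. apply succP; auto. Qed.

Lemma succ_nonempty x : succ x <> empty.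
Proof. apply nonemptyP; exists x; apply mem_succ. Qed.

Lemma opair_inj x y x' y' : ⟨x, y⟩ = ⟨x', y'⟩ -> x = x' /\ y = y'.
Proof.
  unfold opair; intros H.
  assert (Hx : x = x').
  { assert (H1 : upair x' x' ∈ upair (upair x x) (upair x y))
      by (rewrite H; apply upairP; auto).
    apply upairP in H1; destruct H1 as [H1|H1].
    - apply singP; rewrite H1; apply singP; auto.
    - apply singP; rewrite H1; apply upairP; auto. }
  subst x'; split; [reflexivity|].
  assert (H1 : upair x y ∈ upair (upair x x) (upair x y')).
  { rewrite <- H; apply upairP; auto. }
  assert (H2 : upair x y' ∈ upair (upair x x) (upair x y)).
  { rewrite H; apply upairP; auto. }
  apply upairP in H1; apply upairP in H2.
  assert (Hy : y ∈ upair x y) by (apply upairP; auto).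
  assert (Hy' : y' ∈ upair x y') by (apply upairP; auto).
  destruct H1 as [H1|H1]; rewrite H1 in Hy.
  - apply singP in Hy; subst y.
    destruct H2 as [H2|H2]; rewrite H2 in Hy'; apply singP in Hy'; auto.
  - apply upairP in Hy; destruct Hy as [->|]; auto.
    destruct H2 as [H2|H2]; rewrite H2 in Hy'; apply singP in Hy'; auto.
Qed.

Lemma mem_prod a b x y : ⟨x, y⟩ ∈ prod a b <-> x ∈ a /\ y ∈ b.
Proof.
  unfold prod; rewrite sepP; split.
  - intros [_ [x' [y' [H1 [H2 H]]]]]; apply opair_inj in H; destruct H; subst; auto.
  - intros [Hx Hy]; split; [|exists x, y; auto].
    apply powerP; intros w Hw; apply powerP; intros v Hv; apply cupP.
    apply upairP in Hw; destruct Hw; subst w; apply upairP in Hv;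
      destruct Hv; subst; auto.
Qed.

Lemma prodP a b z :
  z ∈ prod a b <-> exists x, x ∈ a /\ exists y, y ∈ b /\ z = ⟨x, y⟩.
Proof.
  split.
  - intros H; apply sepP in H; destruct H as [_ [x [y [? [? ?]]]]]; eauto 6.
  - intros [x [? [y [? ->]]]]; apply mem_prod; auto.
Qed.

(** Uniqueness is asked at one argument only, because [app] is the union of the values related to
    [x]. The lemma thus applies to sets of pairs not yet known to be functions. *)
Lemma app_unique f x y :
  ⟨x, y⟩ ∈ f -> (forall y', ⟨x, y'⟩ ∈ f -> y' = y) -> app f x = y.
Proof.
  intros H1 H2; apply mem_ext; intros z; unfold app; rewrite bigcupP; split.
  - intros [w [Hw Hz]]; apply sepP in Hw; destruct Hw as [_ Hw].
    rewrite <- (H2 _ Hw); exact Hz.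
  - intros Hz; exists y; split; [|exact Hz]; apply sepP; split; [|exact H1].
    apply bigcupP; exists (upair x y); split; [|apply upairP; auto].
    apply bigcupP; exists ⟨x, y⟩; split; [exact H1|].
    apply upairP; auto.
Qed.

Lemma fun_dom f a b x y : is_fun f a b -> ⟨x, y⟩ ∈ f -> x ∈ a /\ y ∈ b.
Proof. intros [H _] Hf; apply mem_prod; auto. Qed.

Lemma fun_functional f a b x y y' :
  is_fun f a b -> ⟨x, y⟩ ∈ f -> ⟨x, y'⟩ ∈ f -> y = y'.
Proof.
  intros Hf H1 H2; destruct (proj2 Hf x (proj1 (fun_dom Hf H1))) as [w [_ Hw]].
  rewrite <- (Hw _ H1), <- (Hw _ H2); reflexivity.
Qed.

Lemma fun_app f a b x y : is_fun f a b -> ⟨x, y⟩ ∈ f -> app f x = y.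
Proof.
  intros Hf H; apply app_unique; [exact H|]; intros y' H'.
  exact (fun_functional Hf H' H).
Qed.

Lemma app_mem f a b x : is_fun f a b -> x ∈ a -> ⟨x, app f x⟩ ∈ f.
Proof.
  intros Hf Hx; destruct (proj2 Hf x Hx) as [y [Hy _]].
  rewrite (fun_app Hf Hy); exact Hy.
Qed.

Lemma app_in f a b x : is_fun f a b -> x ∈ a -> app f x ∈ b.
Proof. intros Hf Hx; exact (proj2 (fun_dom Hf (app_mem Hf Hx))). Qed.

Lemma app_repl a (F : U -> U) x :
  x ∈ a -> app (repl a (fun z => ⟨z, F z⟩)) x = F x.
Proof.
  intros Hx; apply app_unique.
  - apply replP; eauto.
  - intros y H; apply replP in H; destruct H as [z [_ H]].
    apply opair_inj in H; destruct H; subst; auto.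
Qed.

Lemma repl_ext a (F F' : U -> U) :
  (forall x, x ∈ a -> F x = F' x) -> repl a F = repl a F'.
Proof.
  intros H; apply mem_ext; intros z; rewrite !replP; split;
    intros [y [Hy ->]]; exists y; split; auto; symmetry; auto.
Qed.

(** * Induction and order on the natural numbers *)

Lemma infty_inductive : inductive_set (infty U).
Proof.
  split.
  - destruct (infty0 U) as [e [He H]]; replace (empty : U) with e; [exact He|].
    apply mem_ext; intros z; split; intros Hz; [destruct (H z Hz)|destruct (emptyP Hz)].
  - intros n Hn; destruct (inftyS Hn) as [y [Hy H]]; replace (succ n) with y; [exact Hy|].
    apply mem_ext; intros z; rewrite H, succP; tauto.
Qed.

Lemma omega_inductive : inductive_set (omega : U).
Proof.
  split.
  - apply sepP; split; [apply infty_inductive|]; intros x Hx; apply Hx.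
  - intros n Hn; apply sepP in Hn; destruct Hn as [Hn H]; apply sepP; split.
    + apply infty_inductive; exact Hn.
    + intros x Hx; apply Hx, H, Hx.
Qed.

Lemma omega0 : empty ∈ (omega : U).
Proof. apply omega_inductive. Qed.

Lemma omegaS n : n ∈ (omega : U) -> succ n ∈ (omega : U).
Proof. apply omega_inductive. Qed.

(** Separation in the universe accepts every Coq predicate, so [P] cuts an inductive set out of
    [omega] without having to be definable. *)
Lemma omega_ind (P : U -> Prop) :
  P empty -> (forall n, n ∈ (omega : U) -> P n -> P (succ n)) ->
  forall n, n ∈ (omega : U) -> P n.
Proof.
  intros H0 HS n Hn.
  assert (H : n ∈ sep omega P).
  { apply sepP in Hn; apply (proj2 Hn); split.
    - apply sepP; split; [apply omega0|exact H0].
    - intros m Hm; apply sepP in Hm; apply sepP; split; [apply omegaS|apply HS]; apply Hm. }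
  apply sepP in H; apply H.
Qed.

Lemma omega_trans n : n ∈ (omega : U) -> forall k, k ∈ n -> k ∈ (omega : U).
Proof.
  intros Hn; pattern n; revert n Hn; apply omega_ind.
  - intros k Hk; destruct (emptyP Hk).
  - intros n Hn IH k Hk; apply succP in Hk; destruct Hk; subst; auto.
Qed.

Lemma nat_trans n : n ∈ (omega : U) -> forall k j, k ∈ n -> j ∈ k -> j ∈ n.
Proof.
  intros Hn; pattern n; revert n Hn; apply omega_ind.
  - intros k j Hk; destruct (emptyP Hk).
  - intros n Hn IH k j Hk Hj; apply succP; left; apply succP in Hk; destruct Hk; subst; eauto.
Qed.

Lemma succ_mem_succ n : n ∈ (omega : U) -> forall k, k ∈ n -> succ k ∈ succ n.
Proof.
  intros Hn; pattern n; revert n Hn; apply omega_ind.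
  - intros k Hk; destruct (emptyP Hk).
  - intros n Hn IH k Hk; apply succP in Hk; destruct Hk as [Hk| ->].
    + apply succP; left; auto.
    + apply mem_succ.
Qed.

Lemma nat_cases n : n ∈ (omega : U) -> n = empty \/ empty ∈ n.
Proof.
  intros Hn; pattern n; revert n Hn; apply omega_ind; auto.
  intros n Hn [->|H]; right; apply succP; auto.
Qed.

Lemma nat_trichotomy n m :
  n ∈ (omega : U) -> m ∈ (omega : U) -> n ∈ m \/ n = m \/ m ∈ n.
Proof.
  intros Hn; revert m; pattern n; revert n Hn; apply omega_ind.
  - intros m Hm; destruct (nat_cases Hm); auto.
  - intros n Hn IH m Hm; destruct (IH m Hm) as [H|[->|H]].
    + apply (succ_mem_succ Hm) in H; apply succP in H; destruct H; auto.
    + right; right; apply mem_succ.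
    + right; right; apply succP; auto.
Qed.

End Basic.

(** * Definability over a transitive model *)

Section Definability.
Context {U : Universe} (C : U -> Prop).
Hypothesis Ct : transitive_class C.
Hypothesis Cz : ZF C.
Implicit Types (e : nat -> U) (P Q : (nat -> U) -> Prop) (s t : (nat -> U) -> U).

Definition in_class e : Prop := forall i, C (e i).

Lemma in_class_scons x e : C x -> in_class e -> in_class (scons x e).
Proof. intros Hx He [|i]; simpl; auto. Qed.

(* Predicates and operations on environments are kept as Coq functions of the
   environment; [fun n => e (S n)] undoes [scons]. *)
Definition definable P : Prop :=
  exists p, forall e, in_class e -> (sat C e p <-> P e).

(** Closure of [C] under the operation is part of the notion: it allows a term to be eliminated by a
    quantifier over [C], and it is what finally puts concrete sets into the model. *)
Definition definable_term t : Prop :=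
  (forall e, in_class e -> C (t e)) /\
  definable (fun e => e 0 = t (fun n => e (S n))).

Lemma definable_ext P Q :
  (forall e, in_class e -> (P e <-> Q e)) -> definable P -> definable Q.
Proof.
  intros H [p Hp]; exists p; intros e He; rewrite (Hp e He); auto.
Qed.

Lemma definable_false : definable (fun _ => False).
Proof. exists fFalse; simpl; tauto. Qed.

Lemma definable_imp P Q :
  definable P -> definable Q -> definable (fun e => P e -> Q e).
Proof.
  intros [p Hp] [q Hq]; exists (fImp p q); intros e He; simpl.
  rewrite (Hp e He), (Hq e He); tauto.
Qed.

Lemma definable_not P : definable P -> definable (fun e => ~ P e).
Proof. intros H; apply definable_imp; [exact H|apply definable_false]. Qed.

Lemma definable_and P Q :
  definable P -> definable Q -> definable (fun e => P e /\ Q e).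
Proof.
  intros HP HQ; apply definable_ext with (fun e => ~ (P e -> ~ Q e)).
  - intros e _; tauto.
  - apply definable_not, definable_imp; [exact HP|apply definable_not, HQ].
Qed.

Lemma definable_or P Q :
  definable P -> definable Q -> definable (fun e => P e \/ Q e).
Proof.
  intros HP HQ; apply definable_ext with (fun e => ~ P e -> Q e).
  - intros e _; tauto.
  - apply definable_imp; [apply definable_not, HP|exact HQ].
Qed.

Lemma definable_iff P Q :
  definable P -> definable Q -> definable (fun e => P e <-> Q e).
Proof.
  intros HP HQ; apply definable_and; apply definable_imp; assumption.
Qed.

Lemma definable_all (Q : U -> (nat -> U) -> Prop) :
  definable (fun e => Q (e 0) (fun n => e (S n))) ->
  definable (fun e => forall x, C x -> Q x e).
Proof.
  intros [p Hp]; exists (fAll p); intros e He; simpl; split; intros H x Hx.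
  - apply (Hp _ (in_class_scons Hx He)), H, Hx.
  - apply (Hp _ (in_class_scons Hx He)), H, Hx.
Qed.

Lemma definable_ex (Q : U -> (nat -> U) -> Prop) :
  definable (fun e => Q (e 0) (fun n => e (S n))) ->
  definable (fun e => exists x, C x /\ Q x e).
Proof.
  intros H; apply definable_ext with (fun e => ~ forall x, C x -> ~ Q x e).
  - intros e _; split.
    + intros H1; apply NNPP; intros H2; apply H1; intros x Hx HQ; apply H2; eauto.
    + intros [x [Hx HQ]] H1; exact (H1 x Hx HQ).
  - apply definable_not, (definable_all (Q := fun x e => ~ Q x e)), definable_not, H.
Qed.

(** * Renaming of variables and substitution of terms *)

Fixpoint rename (r : nat -> nat) (p : formula) : formula :=
  match p with
  | fMem i j => fMem (r i) (r j)
  | fEq i j => fEq (r i) (r j)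
  | fFalse => fFalse
  | fImp p q => fImp (rename r p) (rename r q)
  | fAll p => fAll (rename (fun i => match i with 0 => 0 | S i => S (r i) end) p)
  end.

Lemma sat_rename p : forall r e e',
  (forall i, e' i = e (r i)) -> (sat C e (rename r p) <-> sat C e' p).
Proof.
  induction p as [i j|i j| |p IHp q IHq|p IHp]; intros r e e' H; simpl.
  - rewrite !H; tauto.
  - rewrite !H; tauto.
  - tauto.
  - rewrite (IHp r e e' H), (IHq r e e' H); tauto.
  - assert (HI : forall x, sat C (scons x e)
        (rename (fun i => match i with 0 => 0 | S i => S (r i) end) p) <->
        sat C (scons x e') p).
    { intros x; apply IHp; intros [|i]; simpl; auto. }
    split; intros H1 x Hx; apply HI, H1, Hx.
Qed.

Lemma definable_rename (r : nat -> nat) P :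
  definable P -> definable (fun e => P (fun i => e (r i))).
Proof.
  intros [p Hp]; exists (rename r p); intros e He.
  rewrite (sat_rename p (e' := fun i => e (r i))); [|reflexivity].
  apply Hp; intros i; apply He.
Qed.

(** The value of the term is named by an existential quantifier over [C]; nothing is lost because
    the value lies in [C]. *)
Lemma definable_subst (Q : U -> (nat -> U) -> Prop) t :
  definable_term t -> definable (fun e => Q (e 0) (fun n => e (S n))) ->
  definable (fun e => Q (t e) e).
Proof.
  intros [Ht Dt] HQ.
  apply definable_ext with (fun e => exists x, C x /\ (x = t e /\ Q x e)).
  - intros e He; split.
    + intros [x [_ [-> H]]]; exact H.
    + intros H; exists (t e); auto.
  - apply (definable_ex (Q := fun x e => x = t e /\ Q x e)), definable_and; assumption.
Qed.

Lemma term_shift t : definable_term t -> definable_term (fun e => t (fun n => e (S n))).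
Proof.
  intros [Ht Dt]; split.
  - intros e He; apply Ht; intros i; apply He.
  - exact (definable_rename (fun i => match i with 0 => 0 | S i => S (S i) end) Dt).
Qed.

Lemma term_var i : definable_term (fun e => e i).
Proof.
  split; [intros e He; apply He|]; exists (fEq 0 (S i)); simpl; tauto.
Qed.

Lemma definable_mem s t :
  definable_term s -> definable_term t -> definable (fun e => s e ∈ t e).
Proof.
  intros Hs Ht; apply (definable_subst (Q := fun x e => x ∈ t e) Hs).
  apply (definable_subst (Q := fun y e => e 0 ∈ y) (term_shift Ht)).
  exists (fMem 1 0); simpl; tauto.
Qed.

Lemma definable_eq s t :
  definable_term s -> definable_term t -> definable (fun e => s e = t e).
Proof.
  intros Hs Ht; apply (definable_subst (Q := fun x e => x = t e) Hs).
  apply (definable_subst (Q := fun y e => e 0 = y) (term_shift Ht)).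
  exists (fEq 1 0); simpl; tauto.
Qed.

(** The bounded quantifier ranges over the whole universe. As [C] is transitive, all elements of
    [t e] lie in [C], so relativizing the quantifier changes nothing. *)
Lemma definable_ball t (Q : U -> (nat -> U) -> Prop) :
  definable_term t -> definable (fun e => Q (e 0) (fun n => e (S n))) ->
  definable (fun e => forall x, x ∈ t e -> Q x e).
Proof.
  intros Ht HQ; apply definable_ext with (fun e => forall x, C x -> x ∈ t e -> Q x e).
  - intros e He; split; intros H x; [|auto].
    intros Hx; apply H; [|exact Hx]; apply (Ct (proj1 Ht e He) Hx).
  - apply (definable_all (Q := fun x e => x ∈ t e -> Q x e)), definable_imp; [|exact HQ].
    apply definable_mem; [apply term_var|apply term_shift, Ht].
Qed.

Lemma definable_bex t (Q : U -> (nat -> U) -> Prop) :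
  definable_term t -> definable (fun e => Q (e 0) (fun n => e (S n))) ->
  definable (fun e => exists x, x ∈ t e /\ Q x e).
Proof.
  intros Ht HQ; apply definable_ext with (fun e => exists x, C x /\ (x ∈ t e /\ Q x e)).
  - intros e He; split; intros [x H]; [firstorder|].
    exists x; split; [|exact H]; apply (Ct (proj1 Ht e He) (proj1 H)).
  - apply (definable_ex (Q := fun x e => x ∈ t e /\ Q x e)), definable_and; [|exact HQ].
    apply definable_mem; [apply term_var|apply term_shift, Ht].
Qed.

(** By transitivity a member of [C] is determined by those of its elements that lie in [C]. The
    graph of [t] is therefore definable as soon as membership in the value is. *)
Lemma term_ext t (Q : U -> (nat -> U) -> Prop) :
  (forall e, in_class e -> C (t e)) ->
  (forall e, in_class e -> forall z, C z -> (z ∈ t e <-> Q z e)) ->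
  definable (fun e => Q (e 0) (fun n => e (S n))) ->
  definable_term t.
Proof.
  intros Ht HQ DQ; split; [exact Ht|].
  apply definable_ext with
    (fun e => forall z, C z -> (z ∈ e 0 <-> Q z (fun n => e (S n)))).
  - intros e He; assert (He' : in_class (fun n => e (S n))) by (intros i; apply He).
    split.
    + intros H; apply mem_ext; intros z; split; intros Hz.
      * pose proof (Ct (He 0) Hz); apply HQ; auto; apply H; auto.
      * pose proof (Ct (Ht _ He') Hz); apply H; auto; apply HQ; auto.
    + intros -> z Hz; apply HQ; auto.
  - apply (definable_all (Q := fun z e => z ∈ e 0 <-> Q z (fun n => e (S n)))).
    apply definable_iff.
    + apply definable_mem; apply term_var.
    + exact (definable_rename (fun i => match i with 0 => 0 | S i => S (S i) end) DQ).
Qed.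

(** * Closure of a transitive model under the set operations *)

Lemma class_upair x y : C x -> C y -> C (upair x y).
Proof.
  intros Hx Hy; destruct (zf_pair Cz Hx Hy) as [z [Hz H]].
  replace (upair x y) with z; [exact Hz|]; apply mem_ext; intros w; rewrite upairP; split.
  - intros Hw; apply H; [exact (Ct Hz Hw)|exact Hw].
  - intros Hw; apply H; [|exact Hw]; destruct Hw; subst; assumption.
Qed.

Lemma class_bigcup x : C x -> C (bigcup x).
Proof.
  intros Hx; destruct (zf_union Cz Hx) as [z [Hz H]].
  replace (bigcup x) with z; [exact Hz|]; apply mem_ext; intros w; rewrite bigcupP; split.
  - intros Hw; apply H in Hw; [|exact (Ct Hz Hw)]; destruct Hw as [y Hy]; exists y; tauto.
  - intros [y [Hy Hw]]; pose proof (Ct Hx Hy) as Cy; apply H; [exact (Ct Cy Hw)|eauto].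
Qed.

Lemma class_sep P e a :
  definable P -> in_class e -> C a -> C (sep a (fun x => P (scons x e))).
Proof.
  intros [p Hp] He Ha; destruct (zf_sep Cz p He Ha) as [b [Hb H]].
  replace (sep a (fun x => P (scons x e))) with b; [exact Hb|].
  apply mem_ext; intros w; rewrite sepP; split; intros Hw.
  - pose proof (Ct Hb Hw) as Cw; apply H in Hw; [|exact Cw].
    rewrite <- (Hp _ (in_class_scons Cw He)); exact Hw.
  - pose proof (Ct Ha (proj1 Hw)) as Cw; apply H; [exact Cw|].
    rewrite (Hp _ (in_class_scons Cw He)); exact Hw.
Qed.

Lemma class_replacement P e a :
  definable P -> in_class e -> C a ->
  (forall x, x ∈ a -> exists! y, C y /\ P (scons x (scons y e))) ->
  exists b, C b /\ forall y, y ∈ b <-> C y /\ exists x, x ∈ a /\ P (scons x (scons y e)).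
Proof.
  intros [p Hp] He Ha HP.
  assert (Hs : forall x y, C x -> C y ->
    (sat C (scons x (scons y e)) p <-> P (scons x (scons y e))))
    by (intros x y Cx Cy; apply Hp; auto using in_class_scons).
  destruct (zf_repl Cz (p := p) He Ha) as [b [Hb H]].
  { intros x Cx Hx; destruct (HP x Hx) as [y [[Cy Hy] Hu]]; exists y; split.
    - split; [exact Cy|]; apply Hs; auto.
    - intros y' [Cy' Hy']; apply Hu; split; [exact Cy'|]; apply Hs; auto. }
  exists b; split; [exact Hb|]; intros y; split.
  - intros Hy; pose proof (Ct Hb Hy) as Cy; split; [exact Cy|].
    destruct (proj1 (H y Cy) Hy) as [x [Cx [Hx Hsat]]].
    exists x; split; [exact Hx|]; apply Hs; auto.
  - intros [Cy [x [Hx HPx]]]; pose proof (Ct Ha Hx) as Cx; apply H; [exact Cy|].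
    exists x; repeat split; auto; apply Hs; auto.
Qed.

Lemma class_repl P e a (F : U -> U) :
  definable P -> in_class e -> C a -> (forall x, x ∈ a -> C (F x)) ->
  (forall x y, x ∈ a -> C y -> (P (scons x (scons y e)) <-> y = F x)) ->
  C (repl a F).
Proof.
  intros DP He Ha HF HP; destruct (class_replacement DP He Ha) as [b [Hb H]].
  { intros x Hx; exists (F x); split.
    - split; [auto|]; apply HP; auto.
    - intros y [Cy Hy]; symmetry; apply (HP x); auto. }
  replace (repl a F) with b; [exact Hb|].
  apply mem_ext; intros w; rewrite H, replP; split.
  - intros [Cw [x [Hx HPx]]]; exists x; split; [exact Hx|]; apply (HP x); auto.
  - intros [x [Hx ->]]; split; [auto|]; exists x; split; [exact Hx|]; apply HP; auto.
Qed.

Lemma class_empty x : C x -> C empty.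
Proof.
  intros Hx.
  replace (empty : U) with (sep x (fun z => False)).
  - exact (class_sep (e := fun _ => x) definable_false (fun _ => Hx) Hx).
  - apply mem_ext; intros z; rewrite sepP; split; [tauto|intros H; destruct (emptyP H)].
Qed.

Lemma term_empty : definable_term (fun _ => empty).
Proof.
  apply term_ext with (fun _ _ => False).
  - intros e He; exact (class_empty (He 0)).
  - intros e He z _; split; [apply emptyP|tauto].
  - apply definable_false.
Qed.

Lemma term_upair s t :
  definable_term s -> definable_term t -> definable_term (fun e => upair (s e) (t e)).
Proof.
  intros Hs Ht; apply term_ext with (fun z e => z = s e \/ z = t e).
  - intros e He; apply class_upair; [apply Hs|apply Ht]; exact He.
  - intros e He z _; apply upairP.
  - apply definable_or; apply definable_eq; auto using term_var, term_shift.
Qed.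

Lemma term_bigcup t : definable_term t -> definable_term (fun e => bigcup (t e)).
Proof.
  intros Ht; apply term_ext with (fun z e => exists y, y ∈ t e /\ z ∈ y).
  - intros e He; apply class_bigcup, Ht, He.
  - intros e He z _; apply bigcupP.
  - apply (definable_bex (Q := fun y e => e 0 ∈ y) (term_shift Ht)).
    apply definable_mem; apply term_var.
Qed.

Lemma term_sep t (Q : U -> (nat -> U) -> Prop) :
  definable_term t -> definable (fun e => Q (e 0) (fun n => e (S n))) ->
  definable_term (fun e => sep (t e) (fun x => Q x e)).
Proof.
  intros Ht HQ; apply term_ext with (fun z e => z ∈ t e /\ Q z e).
  - intros e He; exact (class_sep HQ He (proj1 Ht e He)).
  - intros e He z _; apply sepP.
  - apply definable_and; [|exact HQ].
    apply definable_mem; auto using term_var, term_shift.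
Qed.

Lemma term_repl t (F : U -> (nat -> U) -> U) :
  definable_term t -> definable_term (fun e => F (e 0) (fun n => e (S n))) ->
  definable_term (fun e => repl (t e) (fun x => F x e)).
Proof.
  intros Ht HF; apply term_ext with (fun z e => exists y, y ∈ t e /\ z = F y e).
  - intros e He.
    apply class_repl with (e := e) (P := fun e => e 1 = F (e 0) (fun n => e (S (S n)))).
    (* The graph of [F] has its value in variable 0 and its argument in variable 1; replacement
       expects the reverse, so the two are swapped. *)
    + exact (definable_rename
        (fun i => match i with 0 => 1 | 1 => 0 | S (S i) => S (S i) end) (proj2 HF)).
    + exact He.
    + apply Ht, He.
    + intros x Hx; apply (proj1 HF (scons x e)), in_class_scons; [|exact He].
      exact (Ct (proj1 Ht e He) Hx).
    + intros x y Hx Hy; simpl; tauto.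
  - intros e He z _; apply replP.
  - apply (definable_bex (Q := fun y e => e 0 = F y (fun n => e (S n))) (term_shift Ht)).
    exact (definable_rename
        (fun i => match i with 0 => 1 | 1 => 0 | S (S i) => S (S i) end) (proj2 HF)).
Qed.

Lemma term_opair s t :
  definable_term s -> definable_term t -> definable_term (fun e => ⟨s e, t e⟩).
Proof. intros; unfold opair; auto using term_upair. Qed.

Lemma term_cup s t :
  definable_term s -> definable_term t -> definable_term (fun e => cup (s e) (t e)).
Proof. intros; unfold cup; auto using term_bigcup, term_upair. Qed.

Lemma term_succ t : definable_term t -> definable_term (fun e => succ (t e)).
Proof. intros; unfold succ; auto using term_cup, term_upair. Qed.

Lemma term_app s t :
  definable_term s -> definable_term t -> definable_term (fun e => app (s e) (t e)).
Proof.
  intros Hs Ht; unfold app; apply term_bigcup.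
  apply (term_sep (Q := fun y e => ⟨t e, y⟩ ∈ s e)); [auto using term_bigcup|].
  apply definable_mem; auto using term_opair, term_shift, term_var.
Qed.

(** This is the power set as computed in [C]; the power set of the universe is in general not a
    member of [C]. *)
Definition class_power x : U := sep (power x) C.

Lemma class_powerP x z : z ∈ class_power x <-> powerset_in C x z.
Proof.
  unfold class_power, powerset_in, subset; rewrite sepP, powerP; tauto.
Qed.

Lemma class_class_power x : C x -> C (class_power x).
Proof.
  intros Hx; destruct (zf_power Cz Hx) as [z [Hz H]].
  replace (class_power x) with z; [exact Hz|]; apply mem_ext; intros w.
  rewrite class_powerP; split.
  - intros Hw; pose proof (Ct Hz Hw) as Cw; split; [exact Cw|].
    intros y Hy; exact (proj1 (H w Cw) Hw y (Ct Cw Hy) Hy).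
  - intros [Cw Hw]; apply H; [exact Cw|]; intros y _; apply Hw.
Qed.

Lemma term_class_power t :
  definable_term t -> definable_term (fun e => class_power (t e)).
Proof.
  intros Ht; apply term_ext with (fun z e => forall y, y ∈ z -> y ∈ t e).
  - intros e He; apply class_class_power, Ht, He.
  - intros e He z Cz'; rewrite class_powerP; unfold powerset_in, subset; tauto.
  - apply (definable_ball (Q := fun y e => y ∈ t (fun n => e (S n)))); [apply term_var|].
    apply definable_mem; [apply term_var|exact (term_shift (term_shift Ht))].
Qed.

(** [prod] separates from power sets of the universe. Pairs of members of [C] lie in [C], so the
    power sets computed in [C] already hold every pair, and separation in [C] yields the same
    product. *)
Lemma prod_class_power a b :
  C a -> C b ->
  prod a b = sep (class_power (class_power (cup a b)))
    (fun z => exists x, x ∈ a /\ exists y, y ∈ b /\ z = ⟨x, y⟩).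
Proof.
  intros Ha Hb; apply mem_ext; intros z; rewrite sepP, prodP; split; [|tauto].
  intros H; split; [|exact H]; destruct H as [x [Hx [y [Hy ->]]]].
  pose proof (Ct Ha Hx) as Cx; pose proof (Ct Hb Hy) as Cy.
  apply class_powerP; split; [unfold opair; auto using class_upair|].
  intros w Hw; apply class_powerP; split.
  - apply upairP in Hw; destruct Hw; subst; auto using class_upair.
  - intros v Hv; apply cupP; apply upairP in Hw; destruct Hw; subst w;
      apply upairP in Hv; destruct Hv; subst; auto.
Qed.

Lemma term_prod s t :
  definable_term s -> definable_term t -> definable_term (fun e => prod (s e) (t e)).
Proof.
  intros Hs Ht.
  assert (HQ : definable (fun e => exists x, x ∈ s (fun n => e (S n)) /\
    exists y, y ∈ t (fun n => e (S n)) /\ e 0 = ⟨x, y⟩)).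
  { apply (definable_bex (Q := fun x e => exists y, y ∈ t (fun n => e (S n)) /\ e 0 = ⟨x, y⟩)
             (term_shift Hs)).
    apply (definable_bex (t := fun e => t (fun n => e (S (S n))))
             (Q := fun y e => e 1 = ⟨e 0, y⟩) (term_shift (term_shift Ht))).
    apply definable_eq; auto using term_opair, term_var. }
  apply term_ext with (fun z e => exists x, x ∈ s e /\ exists y, y ∈ t e /\ z = ⟨x, y⟩).
  - intros e He; rewrite prod_class_power; [|apply Hs, He|apply Ht, He].
    apply (class_sep HQ He).
    apply (proj1 (term_class_power (term_class_power (term_cup Hs Ht))) e He).
  - intros e He z _; apply prodP.
  - exact HQ.
Qed.

Lemma definable_inductive t :
  definable_term t -> definable (fun e => inductive_set (t e)).
Proof.
  intros Ht; unfold inductive_set; apply definable_and.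
  - apply definable_mem; auto using term_empty.
  - apply (definable_ball (Q := fun n e => succ n ∈ t e)); [exact Ht|].
    apply definable_mem; auto using term_succ, term_var, term_shift.
Qed.

(* If the [C]-version of omega had a nonstandard element, removing an
   epsilon-minimal one would leave a smaller inductive set. *)
Lemma class_omega : C omega.
Proof.
  destruct (zf_infinity Cz) as [I [CI [[o [Co [HoI Ho]]] HS]]].
  assert (II : inductive_set I).
  { split.
    - replace (empty : U) with o; [exact HoI|]; apply mem_ext; intros z; split; intros Hz.
      + destruct (Ho z (Ct Co Hz) Hz).
      + destruct (emptyP Hz).
    - intros n Hn; destruct (HS n (Ct CI Hn) Hn) as [z [Cz' [Hz H]]].
      replace (succ n) with z; [exact Hz|].
      apply mem_ext; intros w; rewrite succP; split; intros Hw.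
      + apply H; [exact (Ct Cz' Hw)|exact Hw].
      + apply H; [|exact Hw]; destruct Hw as [Hw| ->]; [|exact (Ct CI Hn)].
        exact (Ct (Ct CI Hn) Hw). }
  set (W := sep I (fun n => forall x, C x -> inductive_set x -> n ∈ x)).
  assert (CW : C W).
  { apply (class_sep (P := fun e => forall x, C x -> inductive_set x -> e 0 ∈ x)
             (e := fun _ => I)); [|intros i; exact CI|exact CI].
    apply (definable_all (Q := fun x e => inductive_set x -> e 0 ∈ x)).
    apply definable_imp; [apply (definable_inductive (term_var 0))|].
    apply definable_mem; apply term_var. }
  assert (IW : inductive_set W).
  { split.
    - apply sepP; split; [apply II|]; intros x _ Hx; apply Hx.
    - intros n Hn; apply sepP in Hn; destruct Hn as [Hn H]; apply sepP; split.
      + apply II, Hn.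
      + intros x Cx Hx; apply Hx, H; assumption. }
  replace (omega : U) with W; [exact CW|].
  apply subset_antisym.
  - intros n Hn; apply NNPP; intros Hn'.
    destruct (mem_minimal (P := fun n => n ∈ W /\ ~ n ∈ (omega : U)) (x := n))
      as [m [[Hm Hm'] Hmin]]; [auto|].
    assert (Hd : m ∈ sep W (fun z => z <> m)).
    { pose proof Hm as Hm1; apply sepP in Hm1; apply Hm1.
      - apply (class_sep (P := fun e => e 0 <> e 1) (e := fun _ => m)).
        + apply definable_not, definable_eq; apply term_var.
        + intros i; exact (Ct CW Hm).
        + exact CW.
      - split.
        + apply sepP; split; [apply IW|]; intros <-; apply Hm', omega0.
        + intros k Hk; apply sepP in Hk; destruct Hk as [Hk Hkm]; apply sepP.
          split; [apply IW, Hk|]; intros <-.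
          apply (Hmin k (mem_succ k)); split; [exact Hk|].
          intros Hk'; apply Hm', omegaS, Hk'. }
    apply sepP in Hd; tauto.
  - intros n Hn; apply sepP in Hn; apply sepP; split; [|intros x _; apply Hn].
    apply Hn; exact II.
Qed.

Lemma term_const_omega : definable_term (fun _ => omega).
Proof.
  apply term_ext with (fun z _ => forall x, C x -> inductive_set x -> z ∈ x).
  - intros; apply class_omega.
  - intros e He z Cz'; split.
    + intros Hz x _ Hx; apply sepP in Hz; apply Hz, Hx.
    + intros H; apply H; [apply class_omega|apply omega_inductive].
  - apply (definable_all (Q := fun x e => inductive_set x -> e 0 ∈ x)).
    apply definable_imp; [apply (definable_inductive (term_var 0))|].
    apply definable_mem; apply term_var.
Qed.

(** The form in which the calculus is applied: a set is presented, up to conversion and with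
    auxiliary definitions unfolded, as a term in an environment listing its parameters. The constant
    tail of the environment supplies the last parameter. *)
Lemma class_term t e : definable_term t -> in_class e -> C (t e).
Proof. intros Ht; apply Ht. Qed.

End Definability.

(** * Well-orderings *)

Ltac definability :=
  repeat (cbv beta; first
    [ assumption
    | apply term_var | apply term_empty | apply term_const_omega
    | apply definable_false | apply definable_iff | apply definable_and | apply definable_or
    | apply definable_bex | apply definable_ball | apply definable_ex | apply definable_all
    | apply definable_not | apply definable_imp | apply definable_mem | apply definable_eq
    | apply term_app | apply term_opair | apply term_succ | apply term_cup | apply term_prod
    | apply term_class_power
    | apply term_upair | apply term_bigcup | apply term_sep | apply term_repl ]).

Ltac in_class :=
  repeat first [ assumption | apply in_class_scons | (intros ?; assumption) ].

Section WellOrdering.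
Context {U : Universe} (M : U -> Prop).
Hypothesis Mt : transitive_class M.
Hypothesis Mz : ZF M.
Variables S c : U.
Hypothesis MS : M S.
Hypothesis Mc : M c.
Hypothesis choice : forall x, M x -> x ⊆ S -> x <> empty -> app c x ∈ x.
Implicit Types x y z F : U.

Definition inter F : U := sep (bigcup F) (fun z => forall y, y ∈ F -> z ∈ y).

Lemma interP F y z : y ∈ F -> (z ∈ inter F <-> forall y, y ∈ F -> z ∈ y).
Proof.
  intros Hy; unfold inter; rewrite sepP, bigcupP; split; [tauto|]; intros H; split; eauto.
Qed.

Definition remove_choice x : U := sep x (fun z => z <> app c x).

(** Families range over [M], which keeps the notion definable over [M]. Removal does nothing to the
    empty set, so closure under it can be required at every member. *)
Definition chain (T : U) : Prop :=
  S ∈ T /\ (forall x, x ∈ T -> remove_choice x ∈ T) /\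
  (forall F, M F -> (forall y, y ∈ F -> y ∈ T) -> F <> empty -> inter F ∈ T).

(* The least [chain], as in Zermelo's second proof of the well-ordering theorem. *)
Definition tower : U :=
  sep (class_power M S) (fun x => forall T, M T -> chain T -> x ∈ T).

Lemma class_tower : M tower.
Proof.
  apply (class_term (C := M)
    (t := fun e => sep (class_power M (e 0)) (fun x => forall T, M T ->
       (e 0 ∈ T /\
        (forall x, x ∈ T -> sep x (fun z => z <> app (e 1) x) ∈ T) /\
        (forall F, M F -> (forall y, y ∈ F -> y ∈ T) -> F <> empty ->
          sep (bigcup F) (fun z => forall y, y ∈ F -> z ∈ y) ∈ T)) -> x ∈ T))
    (e := scons S (fun _ => c))).
  - definability.
  - in_class.
Qed.

Lemma class_remove_choice x : M x -> M (remove_choice x).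
Proof.
  intros Hx; apply (class_term (C := M)
    (t := fun e => sep (e 0) (fun z => z <> app (e 1) (e 0))) (e := scons x (fun _ => c))).
  - definability.
  - in_class.
Qed.

Lemma class_inter F : M F -> M (inter F).
Proof.
  intros HF; apply (class_term (C := M)
    (t := fun e => sep (bigcup (e 0)) (fun z => forall y, y ∈ e 0 -> z ∈ y)) (e := fun _ => F)).
  - definability.
  - in_class.
Qed.

Lemma tower_subset x : x ∈ tower -> x ⊆ S.
Proof.
  intros Hx; apply sepP in Hx; destruct Hx as [Hx _]; apply class_powerP in Hx; apply Hx.
Qed.

Lemma tower_chain : chain tower.
Proof.
  repeat split.
  - apply sepP; split; [apply class_powerP; split; [exact MS|intros z; auto]|].
    intros T _ HT; apply HT.
  - intros x Hx; apply sepP in Hx; destruct Hx as [Hx H]; apply class_powerP in Hx.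
    apply sepP; split; [apply class_powerP; split|].
    + apply class_remove_choice, Hx.
    + intros z Hz; apply sepP in Hz; apply Hx, Hz.
    + intros T MT HT; apply HT, H; assumption.
  - intros F MF HF HF0; destruct (proj1 (nonemptyP F) HF0) as [y Hy].
    apply sepP; split; [apply class_powerP; split|].
    + apply class_inter, MF.
    + intros z Hz; apply (tower_subset (HF y Hy)); apply (interP z Hy); assumption.
    + intros T MT HT; apply HT; [exact MF| |exact HF0].
      intros w Hw; specialize (HF w Hw); apply sepP in HF; apply HF; assumption.
Qed.

(** The tower is minimal only among the chains belonging to [M]; hence the premise that the part of
    it satisfying [P] is a set of [M]. *)
Lemma tower_ind (P : U -> Prop) :
  M (sep tower P) -> P S ->
  (forall x, x ∈ tower -> P x -> P (remove_choice x)) ->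
  (forall F, (forall y, y ∈ F -> y ∈ tower) -> F <> empty ->
     (forall y, y ∈ F -> P y) -> P (inter F)) ->
  forall x, x ∈ tower -> P x.
Proof.
  intros MP HS Hr Hi x Hx.
  destruct tower_chain as [TS [Tr Ti]].
  assert (H : chain (sep tower P)).
  { repeat split.
    - apply sepP; auto.
    - intros y Hy; apply sepP in Hy; destruct Hy; apply sepP; auto.
    - intros F MF HF HF0.
      assert (HF1 : forall y, y ∈ F -> y ∈ tower)
        by (intros y Hy; apply HF, sepP in Hy; apply Hy).
      apply sepP; split; [auto|]; apply Hi; auto.
      intros y Hy; apply HF, sepP in Hy; apply Hy. }
  apply sepP in Hx; destruct Hx as [_ Hx].
  specialize (Hx _ MP H); apply sepP in Hx; apply Hx.
Qed.

Lemma remove_choice_subset x : remove_choice x ⊆ x.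
Proof. intros z Hz; apply sepP in Hz; apply Hz. Qed.

Definition comparable x : Prop := forall y, y ∈ tower -> y ⊆ x \/ x ⊆ y.

(** A comparable [x] splits the tower: whatever lies properly below [x] has already lost the element
    chosen from [x]. Comparability alone does not give this, so it is proved by induction on [y]. *)
Lemma comparable_step x :
  x ∈ tower -> comparable x -> forall y, y ∈ tower -> x ⊆ y \/ y ⊆ remove_choice x.
Proof.
  intros Tx Hx; apply tower_ind.
  - apply (class_term (C := M)
      (t := fun e => sep (e 0) (fun y => (forall z, z ∈ e 1 -> z ∈ y) \/
         (forall z, z ∈ y -> z ∈ sep (e 1) (fun z => z <> app (e 2) (e 1)))))
      (e := scons tower (scons x (fun _ => c)))).
    + definability.
    + in_class; [apply class_tower|exact (Mt class_tower Tx)].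
  - left; apply tower_subset, Tx.
  - intros y Ty [H|H].
    (* If the element removed from [y] lies in [x], comparing [x] with what remains of [y] either
       settles the claim or forces [x = y]. *)
    + destruct (classic (app c y ∈ x)) as [Hc|Hc].
      * destruct (Hx (remove_choice y) (proj1 (proj2 tower_chain) y Ty)) as [H1|H1]; [|auto].
        right; replace y with x; [intros z; auto|].
        apply subset_antisym; [exact H|]; intros z Hz.
        destruct (classic (z = app c y)) as [->|Hz']; [exact Hc|].
        apply H1, sepP; auto.
      * left; intros z Hz; apply sepP; split; [auto|]; intros ->; auto.
    + right; intros z Hz; apply H, remove_choice_subset, Hz.
  - intros F HF HF0 IH; destruct (proj1 (nonemptyP F) HF0) as [w Hw].
    destruct (classic (exists y, y ∈ F /\ y ⊆ remove_choice x)) as [[y [Hy H]]|H].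
    + right; intros z Hz; apply H; apply (interP z Hy); assumption.
    + left; intros z Hz; apply (interP z Hw); intros y Hy.
      destruct (IH y Hy) as [H'|H']; [auto|exfalso; eauto].
Qed.

(** A second induction, in which [comparable_step] is the removal case. For an intersection, either
    one factor lies below [y], or all factors contain [y]. *)
Lemma tower_comparable x : x ∈ tower -> comparable x.
Proof.
  revert x; apply tower_ind.
  - apply (class_term (C := M)
      (t := fun e => sep (e 0) (fun x => forall y, y ∈ e 0 ->
         (forall z, z ∈ y -> z ∈ x) \/ (forall z, z ∈ x -> z ∈ y))) (e := fun _ => tower)).
    + definability.
    + intros _; apply class_tower.
  - intros y Hy; left; apply tower_subset, Hy.
  - intros x Tx Hx y Ty; destruct (comparable_step Tx Hx Ty) as [H|H]; [|auto].
    right; intros z Hz; apply H, remove_choice_subset, Hz.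
  - intros F HF HF0 IH y Ty; destruct (proj1 (nonemptyP F) HF0) as [w Hw].
    destruct (classic (exists z, z ∈ F /\ z ⊆ y)) as [[v [Hv H]]|H].
    + right; intros z Hz; apply H; apply (interP z Hv); assumption.
    + left; intros z Hz; apply (interP z Hw); intros v Hv.
      destruct (IH v Hv y Ty) as [H'|H']; [auto|exfalso; eauto].
Qed.

(** Elements are ordered by the stage at which they are removed: [a] precedes [b] when some member
    of the tower has lost [a] but still has [b]. *)
Definition tower_order : U :=
  sep (prod S S) (fun p => exists a, a ∈ S /\ exists b, b ∈ S /\
    p = ⟨a, b⟩ /\ exists x, x ∈ tower /\ b ∈ x /\ ~ a ∈ x).

Lemma tower_orderP a b :
  a ∈ S -> b ∈ S ->
  (⟨a, b⟩ ∈ tower_order <-> exists x, x ∈ tower /\ b ∈ x /\ ~ a ∈ x).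
Proof.
  intros Ha Hb; unfold tower_order; rewrite sepP; split.
  - intros [_ [a' [_ [b' [_ [H H']]]]]]; apply opair_inj in H; destruct H; subst; auto.
  - intros H; split; [apply mem_prod; auto|eauto 7].
Qed.

(** Take the intersection of all members of the tower that include [X]. The element chosen from it
    lies in [X], since otherwise its removal would leave a smaller member including [X]. The set
    left after the removal separates this element from the rest of [X]. *)
Lemma tower_order_least X :
  M X -> X ⊆ S -> X <> empty ->
  exists x, x ∈ X /\ forall y, y ∈ X -> x = y \/ ⟨x, y⟩ ∈ tower_order.
Proof.
  intros MX HX HX0; destruct (proj1 (nonemptyP X) HX0) as [w Hw].
  set (F := sep tower (fun B => forall z, z ∈ X -> z ∈ B)).
  destruct tower_chain as [TS [Tr Ti]].
  assert (FS : S ∈ F) by (apply sepP; auto).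
  assert (MF : M F).
  { apply (class_term (C := M)
      (t := fun e => sep (e 0) (fun B => forall z, z ∈ e 1 -> z ∈ B))
      (e := scons tower (fun _ => X))).
    - definability.
    - in_class; apply class_tower. }
  assert (TA : inter F ∈ tower).
  { apply Ti; [exact MF| |apply nonemptyP; eauto]; intros y Hy; apply sepP in Hy; apply Hy. }
  assert (XA : X ⊆ inter F).
  { intros z Hz; apply (interP z FS); intros B HB; apply sepP in HB; apply HB, Hz. }
  assert (cA : app c (inter F) ∈ inter F).
  { apply choice; [exact (Mt class_tower TA)|apply tower_subset, TA|].
    apply nonemptyP; exists w; auto. }
  assert (cX : app c (inter F) ∈ X).
  { apply NNPP; intros H.
    assert (HD : remove_choice (inter F) ∈ F).
    { apply sepP; split; [apply Tr, TA|]; intros z Hz; apply sepP; split; [auto|].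
      intros ->; auto. }
    pose proof (proj1 (interP (app c (inter F)) FS) cA _ HD) as H1.
    apply sepP in H1; tauto. }
  exists (app c (inter F)); split; [exact cX|]; intros y Hy.
  destruct (classic (app c (inter F) = y)) as [|Hne]; [auto|right].
  apply tower_orderP; auto; exists (remove_choice (inter F)); repeat split.
  - apply Tr, TA.
  - apply sepP; split; auto.
  - intros H; apply sepP in H; tauto.
Qed.

Theorem well_orderable_of_choice : well_orderable_in M S.
Proof.
  exists tower_order; split.
  { apply (class_term (C := M)
      (t := fun e => sep (prod (e 0) (e 0)) (fun p => exists a, a ∈ e 0 /\ exists b, b ∈ e 0 /\
         p = ⟨a, b⟩ /\ exists x, x ∈ e 1 /\ b ∈ x /\ ~ a ∈ x))
      (e := scons S (fun _ => tower))).
    - definability.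
    - in_class; intros _; apply class_tower. }
  repeat split.
  - intros x Hx H; apply tower_orderP in H; auto; destruct H as [y Hy]; tauto.
  - intros x y z Hx Hy Hz H1 H2; apply tower_orderP in H1; auto; apply tower_orderP in H2; auto.
    destruct H1 as [A [TA [yA xA]]]; destruct H2 as [B [TB [zB yB]]].
    apply tower_orderP; auto; exists A; repeat split; auto.
    destruct (tower_comparable TA TB) as [H|H]; [auto|]; exfalso; auto.
  (* Trichotomy is read off from the least element of the pair {x, y}. *)
  - intros x y Hx Hy.
    destruct (tower_order_least (X := upair x y)) as [w [Hw H]].
    + apply class_upair; try assumption; [exact (Mt MS Hx)|exact (Mt MS Hy)].
    + intros z Hz; apply upairP in Hz; destruct Hz; subst; auto.
    + apply nonemptyP; exists x; apply upairP; auto.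
    + assert (x ∈ upair x y /\ y ∈ upair x y) as [H1 H2] by (split; apply upairP; auto).
      apply H in H1; apply H in H2; apply upairP in Hw.
      destruct Hw; subst w; intuition auto.
  - exact tower_order_least.
Qed.

End WellOrdering.

(** * Choice for arbitrary families from a well-ordered seed *)

Section ChoiceFromSVC.
Context {U : Universe} (M : U -> Prop).
Hypothesis Mt : transitive_class M.
Hypothesis Mz : ZF M.

Theorem AC_of_SVC (S : U) : M S -> well_orderable_in M S -> SVC M S -> AC M.
Proof.
  intros MS [R [MR [Rirr [Rtrans [_ Rleast]]]]] HSVC X MX HX.
  assert (MU : M (bigcup X)) by (apply class_bigcup; assumption).
  destruct (HSVC _ MU) as [eta [f [Meta [Oeta [Mf [ff fs]]]]]].
  (* Among the indices ⟨s, b⟩ that [f] sends into [x], the lexicographically first one is used, with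
     the ordinal [b] compared before [s]. A least [b] exists by foundation, and then an [R]-least
     [s] by the well-ordering of [S] in [M]. *)
  pose (hit := fun x y => exists b, b ∈ eta /\ exists s, s ∈ S /\
     app f ⟨s, b⟩ = y /\ y ∈ x /\
     (forall b', b' ∈ b -> forall s', s' ∈ S -> ~ app f ⟨s', b'⟩ ∈ x) /\
     (forall s', s' ∈ S -> app f ⟨s', b⟩ ∈ x -> s = s' \/ ⟨s, s'⟩ ∈ R)).
  set (g := sep (prod X (bigcup X))
    (fun p => exists x, x ∈ X /\ exists y, y ∈ x /\ p = ⟨x, y⟩ /\ hit x y)).
  assert (Mg : M g).
  { apply (class_term (C := M) (t := fun e => sep (prod (e 0) (bigcup (e 0)))
      (fun p => exists x, x ∈ e 0 /\ exists y, y ∈ x /\ p = ⟨x, y⟩ /\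
        exists b, b ∈ e 1 /\ exists s, s ∈ e 2 /\
        app (e 3) ⟨s, b⟩ = y /\ y ∈ x /\
        (forall b', b' ∈ b -> forall s', s' ∈ e 2 -> ~ app (e 3) ⟨s', b'⟩ ∈ x) /\
        (forall s', s' ∈ e 2 -> app (e 3) ⟨s', b⟩ ∈ x -> s = s' \/ ⟨s, s'⟩ ∈ e 4)))
      (e := scons X (scons eta (scons S (scons f (fun _ => R)))))).
    - definability.
    - in_class. }
  assert (gP : forall x y, ⟨x, y⟩ ∈ g <-> x ∈ X /\ y ∈ x /\ hit x y).
  { intros x y; unfold g; rewrite sepP; split.
    - intros [_ [x' [Hx [y' [Hy [H Hh]]]]]]; apply opair_inj in H; destruct H; subst; auto.
    - intros [Hx [Hy Hh]]; split; [|eauto 7].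
      apply mem_prod; split; [exact Hx|]; apply bigcupP; eauto. }
  assert (hit_ex : forall x, x ∈ X -> exists y, hit x y).
  { intros x Hx; destruct (proj1 (nonemptyP x) (HX x Hx)) as [y Hy].
    destruct (fs y) as [p [Hp Hpy]]; [apply bigcupP; eauto|].
    apply prodP in Hp; destruct Hp as [s [Hs [b [Hb ->]]]].
    destruct (mem_minimal
      (P := fun b => b ∈ eta /\ exists s, s ∈ S /\ app f ⟨s, b⟩ ∈ x) (x := b))
      as [b0 [[Hb0 [s0 [Hs0 H0]]] Hmin]].
    { split; [exact Hb|]; exists s; rewrite Hpy; auto. }
    destruct (Rleast (sep S (fun s => app f ⟨s, b0⟩ ∈ x))) as [s1 [Hs1 H1]].
    - apply (class_term (C := M) (t := fun e => sep (e 0) (fun s => app (e 1) ⟨s, e 2⟩ ∈ e 3))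
        (e := scons S (scons f (scons b0 (fun _ => x))))); [definability|].
      in_class; [exact (Mt Meta Hb0)|intros _; exact (Mt MX Hx)].
    - intros z Hz; apply sepP in Hz; apply Hz.
    - apply nonemptyP; exists s0; apply sepP; auto.
    - apply sepP in Hs1; destruct Hs1 as [Hs1 Hs1'].
      exists (app f ⟨s1, b0⟩), b0; split; [exact Hb0|]; exists s1; repeat split; auto.
      + intros b' Hb' s' Hs' H; apply (Hmin b' Hb'); split; [|eauto].
        exact (proj1 Oeta b0 Hb0 b' Hb').
      + intros s' Hs' H; apply H1, sepP; auto. }
  assert (hit_unique : forall x y y', hit x y -> hit x y' -> y = y').
  { intros x y y' [b [Hb [s [Hs [E [Hy [Hlt Hle]]]]]]]
      [b' [Hb' [s' [Hs' [E' [Hy' [Hlt' Hle']]]]]]].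
    subst y y'; destruct (proj2 Oeta b b' Hb Hb') as [H|[<-|H]].
    - destruct (Hlt' b H s Hs Hy).
    - destruct (Hle s' Hs' Hy') as [<-|H1]; [reflexivity|].
      destruct (Hle' s Hs Hy) as [<-|H2]; [reflexivity|].
      destruct (Rirr s Hs); exact (Rtrans s s' s Hs Hs' Hs H1 H2).
    - destruct (Hlt b' H s' Hs' Hy'). }
  assert (gf : is_fun g X (bigcup X)).
  { split; [intros z Hz; apply sepP in Hz; apply Hz|].
    intros x Hx; destruct (hit_ex x Hx) as [y Hy]; exists y; split.
    - apply gP; repeat split; auto; destruct Hy as [b [_ [s [_ Hy]]]]; tauto.
    - intros y' Hy'; apply gP in Hy'; apply (hit_unique x); tauto. }
  exists g; repeat split; [exact Mg|apply gf|apply gf|].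
  intros x Hx; pose proof (app_mem gf Hx) as H; apply gP in H; tauto.
Qed.

End ChoiceFromSVC.

(** * Coding pairs of subsets of [S] *)

Section Coding.
Context {U : Universe} (M : U -> Prop).
Hypothesis Mt : transitive_class M.
Hypothesis Mz : ZF M.
Variable S : U.
Hypothesis MS : M S.
Hypothesis split_S : PPsplit M S.
Implicit Types x y z u Q : U.

Definition image Q y : U :=
  sep (bigcup (bigcup Q)) (fun v => exists u, u ∈ y /\ ⟨u, v⟩ ∈ Q).

Lemma imageP Q y v : v ∈ image Q y <-> exists u, u ∈ y /\ ⟨u, v⟩ ∈ Q.
Proof.
  unfold image; rewrite sepP; split; [tauto|]; intros [u [Hu H]]; split; [|eauto].
  apply bigcupP; exists (upair u v); split; [|apply upairP; auto].
  apply bigcupP; exists ⟨u, v⟩; split; [exact H|apply upairP; auto].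
Qed.

(* A subset [y] of [S] is read as the pair [(image Q0 y, image Q1 y)]. *)
Lemma choice_of_coding Q0 Q1 :
  M Q0 -> M Q1 ->
  (forall x a, M x -> x ⊆ S -> a ∈ x ->
     exists y, M y /\ y ⊆ S /\ image Q0 y = x /\ image Q1 y = a) ->
  exists c, M c /\ forall x, M x -> x ⊆ S -> x <> empty -> app c x ∈ x.
Proof.
  intros M0 M1 H.
  set (X := sep (class_power M S) (fun x => x <> empty)).
  (* [Y] consists of the codes of pairs (x, a) with [a ∈ x ⊆ S]. The membership also makes the first
     coordinate nonempty, so that [f] maps into [X]. *)
  set (Y := sep (class_power M S) (fun y => image Q1 y ∈ image Q0 y /\
    forall z, z ∈ image Q0 y -> z ∈ S)).
  set (f := repl Y (fun y => ⟨y, image Q0 y⟩)).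
  assert (MX : M X).
  { apply (class_term (C := M)
      (t := fun e => sep (class_power M (e 0)) (fun x => x <> empty)) (e := fun _ => S)).
    - definability.
    - in_class. }
  assert (MY : M Y).
  { apply (class_term (C := M)
      (t := fun e => sep (class_power M (e 0)) (fun y =>
        sep (bigcup (bigcup (e 2))) (fun v => exists u, u ∈ y /\ ⟨u, v⟩ ∈ e 2) ∈
        sep (bigcup (bigcup (e 1))) (fun v => exists u, u ∈ y /\ ⟨u, v⟩ ∈ e 1) /\
        forall z, z ∈ sep (bigcup (bigcup (e 1))) (fun v => exists u, u ∈ y /\ ⟨u, v⟩ ∈ e 1) ->
          z ∈ e 0)) (e := scons S (scons Q0 (fun _ => Q1)))).
    - definability.
    - in_class. }
  assert (Mf : M f).
  { apply (class_term (C := M) (t := fun e => repl (e 0) (fun y =>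
        ⟨y, sep (bigcup (bigcup (e 1))) (fun v => exists u, u ∈ y /\ ⟨u, v⟩ ∈ e 1)⟩))
      (e := scons Y (fun _ => Q0))).
    - definability.
    - in_class. }
  assert (MI : forall y, M y -> M (image Q0 y)).
  { intros y My; apply (class_term (C := M) (t := fun e =>
        sep (bigcup (bigcup (e 1))) (fun v => exists u, u ∈ e 0 /\ ⟨u, v⟩ ∈ e 1))
      (e := scons y (fun _ => Q0))).
    - definability.
    - in_class. }
  assert (ff : is_fun f Y X).
  { split.
    - intros p Hp; apply replP in Hp; destruct Hp as [y [Hy ->]]; apply mem_prod.
      split; [exact Hy|]; apply sepP in Hy; destruct Hy as [Hy [Hy1 Hy2]].
      apply class_powerP in Hy; apply sepP; split; [apply class_powerP; split; auto|].
      + apply MI, Hy.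
      + apply nonemptyP; eauto.
    - intros y Hy; exists (image Q0 y); split; [apply replP; eauto|].
      intros x Hx; apply replP in Hx; destruct Hx as [y' [_ E]].
      apply opair_inj in E; destruct E; subst; auto. }
  assert (fE : forall y, y ∈ Y -> app f y = image Q0 y)
    by (intros y Hy; apply app_repl, Hy).
  destruct (split_S (X := X) (Y := Y) (f := f)) as [s [Ms [sf Hs]]]; auto.
  - intros x Hx; apply sepP in Hx; apply class_powerP, Hx.
  - intros y Hy; apply sepP in Hy; apply class_powerP, Hy.
  - split; [exact ff|]; intros x Hx; apply sepP in Hx; destruct Hx as [Hx Hx0].
    apply class_powerP in Hx; destruct Hx as [Mx Hx].
    destruct (proj1 (nonemptyP x) Hx0) as [a Ha].
    destruct (H x a Mx Hx Ha) as [y [My [Hy [E0 E1]]]].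
    assert (HY : y ∈ Y).
    { apply sepP; split; [apply class_powerP; split; auto|].
      rewrite E0, E1; auto. }
    exists y; split; [exact HY|]; rewrite fE; auto.
  (* The splitting picks a code whose first coordinate is [x]; the second coordinate of that code is
     the chosen element. *)
  - exists (repl X (fun x => ⟨x, image Q1 (app s x)⟩)); split.
    { apply (class_term (C := M) (t := fun e => repl (e 0) (fun x =>
          ⟨x, sep (bigcup (bigcup (e 1))) (fun v => exists u, u ∈ app (e 2) x /\ ⟨u, v⟩ ∈ e 1)⟩))
        (e := scons X (scons Q1 (fun _ => s)))).
      - definability.
      - in_class. }
    intros x Mx Hx Hx0.
    assert (HX : x ∈ X) by (apply sepP; split; [apply class_powerP; split|]; auto).
    rewrite (app_repl (fun x => image Q1 (app s x)) HX).
    pose proof (app_in sf HX) as HY; pose proof (fE _ HY) as E.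
    rewrite (Hs x HX) in E; apply sepP in HY; rewrite E at 2; apply HY.
Qed.

(** The code of (x, a) is the preimage of [x] under [Q0] together with the preimage of [a] under
    [Q1], where [a] is a subset of [⋃ S] because it belongs to [S]. Disjoint domains keep the halves
    from interfering; functionality makes the image of a preimage no larger than the given set, and
    surjectivity makes it no smaller. *)
Lemma choice_of_partial_surjections Q0 Q1 :
  M Q0 -> M Q1 ->
  (forall u s, ⟨u, s⟩ ∈ Q0 -> u ∈ S) ->
  (forall u z, ⟨u, z⟩ ∈ Q1 -> u ∈ S) ->
  (forall u s s', ⟨u, s⟩ ∈ Q0 -> ⟨u, s'⟩ ∈ Q0 -> s = s') ->
  (forall u z z', ⟨u, z⟩ ∈ Q1 -> ⟨u, z'⟩ ∈ Q1 -> z = z') ->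
  (forall u s z, ⟨u, s⟩ ∈ Q0 -> ⟨u, z⟩ ∈ Q1 -> False) ->
  (forall s, s ∈ S -> exists u, ⟨u, s⟩ ∈ Q0) ->
  (forall z, z ∈ bigcup S -> exists u, ⟨u, z⟩ ∈ Q1) ->
  exists c, M c /\ forall x, M x -> x ⊆ S -> x <> empty -> app c x ∈ x.
Proof.
  intros M0 M1 D0 D1 F0 F1 Dis O0 O1; apply (choice_of_coding M0 M1).
  intros x a Mx Hx Ha.
  exists (sep S (fun u => (exists s, s ∈ x /\ ⟨u, s⟩ ∈ Q0) \/
                          (exists z, z ∈ a /\ ⟨u, z⟩ ∈ Q1))).
  split; [|split; [|split]].
  - apply (class_term (C := M) (t := fun e => sep (e 0) (fun u =>
        (exists s, s ∈ e 1 /\ ⟨u, s⟩ ∈ e 2) \/ (exists z, z ∈ e 3 /\ ⟨u, z⟩ ∈ e 4)))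
      (e := scons S (scons x (scons Q0 (scons a (fun _ => Q1)))))).
    + definability.
    + in_class; exact (Mt Mx Ha).
  - intros u Hu; apply sepP in Hu; apply Hu.
  - apply mem_ext; intros s; rewrite imageP; split.
    + intros [u [Hu Hus]]; apply sepP in Hu; destruct Hu as [_ [[s' [Hs' H]]|[z [_ H]]]].
      * rewrite (F0 _ _ _ Hus H); exact Hs'.
      * destruct (Dis _ _ _ Hus H).
    + intros Hs; destruct (O0 s (Hx s Hs)) as [u Hu]; exists u; split; [|exact Hu].
      apply sepP; split; [exact (D0 _ _ Hu)|]; eauto.
  - apply mem_ext; intros z; rewrite imageP; split.
    + intros [u [Hu Huz]]; apply sepP in Hu; destruct Hu as [_ [[s [_ H]]|[z' [Hz' H]]]].
      * destruct (Dis _ _ _ H Huz).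
      * rewrite (F1 _ _ _ Huz H); exact Hz'.
    + intros Hz; destruct (O1 z) as [u Hu]; [apply bigcupP; eauto|].
      exists u; split; [|exact Hu]; apply sepP; split; [exact (D1 _ _ Hu)|]; eauto.
Qed.

(** * Block sequences and the two decoding relations *)

Variables A d e : U.
Hypothesis Hd : d ∈ A.
Hypothesis He : e ∈ A.
Hypothesis Hde : d <> e.
Hypothesis fun_S : forall s, s ∈ S -> is_fun s omega A.

(* [u] takes the value [e] on the open interval (n, m), and [d] at all other
   positive places; [u 0] is left free. *)
Definition block u n m : Prop :=
  forall k, k ∈ (omega : U) -> k <> empty ->
    (n ∈ k /\ k ∈ m -> app u k = e) /\ (~ (n ∈ k /\ k ∈ m) -> app u k = d).

Hypothesis block_S : forall b n m, b ∈ A -> n ∈ (omega : U) -> m ∈ (omega : U) ->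
  exists u, u ∈ S /\ app u empty = b /\ block u n m.

Lemma blockP u n m k :
  block u n m -> k ∈ (omega : U) -> k <> empty -> (app u k = e <-> n ∈ k /\ k ∈ m).
Proof.
  intros H Hk Hk0; destruct (H k Hk Hk0) as [H1 H2]; split; [|exact H1].
  intros E; apply NNPP; intros H'; apply Hde; rewrite <- (H2 H'); exact E.
Qed.

Lemma block_unique u u' n m :
  u ∈ S -> u' ∈ S -> block u n m -> block u' n m -> app u empty = app u' empty -> u = u'.
Proof.
  intros Hu Hu' B B' E.
  assert (H : forall k, k ∈ (omega : U) -> app u k = app u' k).
  { intros k Hk; destruct (classic (k = empty)) as [->|Hk0]; [exact E|].
    destruct (B k Hk Hk0) as [H1 H2], (B' k Hk Hk0) as [H1' H2'].
    destruct (classic (n ∈ k /\ k ∈ m)) as [Hm|Hm].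
    - rewrite H1, H1'; auto.
    - rewrite H2, H2'; auto. }
  assert (Hsub : forall v v', v ∈ S -> v' ∈ S ->
    (forall k, k ∈ (omega : U) -> app v k = app v' k) -> v ⊆ v').
  { intros v v' Hv Hv' Hk z Hz; pose proof (fun_S Hv) as fv; pose proof (fun_S Hv') as fv'.
    pose proof (proj1 fv z Hz) as Hp; apply prodP in Hp; destruct Hp as [k [Ik [w [_ ->]]]].
    rewrite <- (fun_app fv Hz), Hk; [|exact Ik]; apply (app_mem fv' Ik). }
  apply subset_antisym; apply Hsub; auto; intros k Hk; symmetry; auto.
Qed.

Lemma succ_inj (n m : U) : succ n = succ m -> n = m.
Proof.
  intros E; pose proof (mem_succ n) as H1; pose proof (mem_succ m) as H2.
  rewrite E in H1; rewrite <- E in H2; apply succP in H1; apply succP in H2.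
  destruct H1 as [H1|]; auto; destruct H2 as [H2|]; auto; destruct (mem_asym H1 H2).
Qed.

(** Both ends of a nonempty run can be read off. If [n ∈ n'], the place [succ n] carries [e] by the
    first description but not by the second. If [m ∈ m'], the place [m] carries [e] by the second
    description, whose run starts below [m], but not by the first. *)
Lemma block_inj_le u n m n' m' :
  n ∈ (omega : U) -> n' ∈ (omega : U) -> m ∈ (omega : U) -> m' ∈ (omega : U) ->
  succ n ∈ m -> succ n' ∈ m' -> block u n m -> block u n' m' -> ~ n ∈ n' /\ ~ m ∈ m'.
Proof.
  intros Hn Hn' Hm Hm' V V' B B'; split; intros H.
  - assert (H1 : app u (succ n) = e).
    { apply (blockP B); auto using omegaS, succ_nonempty, mem_succ. }
    apply (blockP B') in H1; auto using omegaS, succ_nonempty.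
    destruct H1 as [H1 _]; apply succP in H1; destruct H1 as [H1| ->].
    + exact (mem_asym H H1).
    + exact (mem_irrefl H).
  - assert (Hm0 : m <> empty) by (apply nonemptyP; eauto).
    assert (H1 : app u m = e).
    { apply (blockP B'); auto; split; [|exact H].
      assert (H1 : app u (succ n') = e).
      { apply (blockP B'); auto using omegaS, succ_nonempty, mem_succ. }
      apply (blockP B) in H1; auto using omegaS, succ_nonempty.
      destruct H1 as [_ H1]; exact (nat_trans Hm H1 (mem_succ n')). }
    apply (blockP B) in H1; auto; destruct H1 as [_ H1]; exact (mem_irrefl H1).
Qed.

Lemma block_inj u n m n' m' :
  n ∈ (omega : U) -> n' ∈ (omega : U) -> m ∈ (omega : U) -> m' ∈ (omega : U) ->
  succ n ∈ m -> succ n' ∈ m' -> block u n m -> block u n' m' -> n = n' /\ m = m'.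
Proof.
  intros Hn Hn' Hm Hm' V V' B B'.
  destruct (block_inj_le Hn Hn' Hm Hm' V V' B B') as [H1 H2].
  destruct (block_inj_le Hn' Hn Hm' Hm V' V B' B) as [H3 H4].
  destruct (nat_trichotomy Hn Hn') as [?|[?|?]]; try tauto.
  destruct (nat_trichotomy Hm Hm') as [?|[?|?]]; tauto.
Qed.

(** The condition [succ n ∈ m] puts the place [succ n] into the run; an empty run would not
    determine [n] and [m]. *)
Definition special u : Prop :=
  exists n, n ∈ (omega : U) /\ exists m, m ∈ (omega : U) /\ succ n ∈ m /\ block u n m.

(* The elements of [S] coding a block (n, m + 1) are moved to the block (n, m),
   which frees those coding (n, n + 2). *)
Definition shift_block : U :=
  sep (prod S S) (fun p => exists u, u ∈ S /\ exists s, s ∈ S /\ p = ⟨u, s⟩ /\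
    ((u = s /\ ~ special u) \/
     exists n, n ∈ omega /\ exists m, m ∈ omega /\ succ n ∈ m /\
       block u n (succ m) /\ block s n m /\ app u empty = app s empty)).

(** The members of [⋃ S] are the pairs ⟨k, b⟩ occurring in the sequences. The pair ⟨n, b⟩ is decoded
    from a shortest block: its run is the single place [succ n], and [b] stands at place 0. *)
Definition decode_block : U :=
  sep (prod S (bigcup S)) (fun p => exists u, u ∈ S /\ exists n, n ∈ omega /\
    p = ⟨u, ⟨n, app u empty⟩⟩ /\ block u n (succ (succ n))).

Lemma shift_blockP u s : ⟨u, s⟩ ∈ shift_block <-> u ∈ S /\ s ∈ S /\
    ((u = s /\ ~ special u) \/
     exists n, n ∈ omega /\ exists m, m ∈ omega /\ succ n ∈ m /\
       block u n (succ m) /\ block s n m /\ app u empty = app s empty).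
Proof.
  unfold shift_block; rewrite sepP; split.
  - intros [_ [u' [Hu [s' [Hs [E H]]]]]]; apply opair_inj in E; destruct E; subst; auto.
  - intros [Hu [Hs H]]; split; [apply mem_prod; auto|]; exists u; eauto.
Qed.

Lemma decode_blockP u z : ⟨u, z⟩ ∈ decode_block <->
  u ∈ S /\ z ∈ bigcup S /\ exists n, n ∈ omega /\ z = ⟨n, app u empty⟩ /\
    block u n (succ (succ n)).
Proof.
  unfold decode_block; rewrite sepP; split.
  - intros [H1 [u' [Hu [n [Hn [E H]]]]]]; apply mem_prod in H1.
    apply opair_inj in E; destruct E; subst u' z.
    split; [tauto|]; split; [tauto|]; eauto.
  - intros [Hu [Hz [n [Hn [-> H]]]]]; split; [apply mem_prod; auto|]; exists u; eauto.
Qed.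

Lemma block_special u n m :
  n ∈ (omega : U) -> m ∈ (omega : U) -> succ n ∈ m -> block u n m -> special u.
Proof. intros; exists n; eauto. Qed.

(** The reals enter [M] as values at 0 of members of [S]. *)
Lemma class_value b : b ∈ A -> M b.
Proof.
  intros Hb; destruct (block_S Hb omega0 omega0) as [u [Hu [<- _]]].
  apply (class_term (C := M) (t := fun e => app (e 0) empty) (e := fun _ => u)).
  - definability.
  - intros _; exact (Mt MS Hu).
Qed.

Theorem choice_of_blocks :
  exists c, M c /\ forall x, M x -> x ⊆ S -> x <> empty -> app c x ∈ x.
Proof.
  pose proof (class_value Hd) as Md; pose proof (class_value He) as Me.
  apply (choice_of_partial_surjections (Q0 := shift_block) (Q1 := decode_block)).
  - apply (class_term (C := M) (t := fun v =>
      sep (prod (v 0) (v 0)) (fun p => exists u, u ∈ v 0 /\ exists s, s ∈ v 0 /\ p = ⟨u, s⟩ /\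
    ((u = s /\ ~ exists n, n ∈ omega /\ exists m, m ∈ omega /\ succ n ∈ m /\
         forall k, k ∈ omega -> k <> empty ->
           (n ∈ k /\ k ∈ m -> app u k = v 2) /\ (~ (n ∈ k /\ k ∈ m) -> app u k = v 1)) \/
     exists n, n ∈ omega /\ exists m, m ∈ omega /\ succ n ∈ m /\
       (forall k, k ∈ omega -> k <> empty ->
           (n ∈ k /\ k ∈ succ m -> app u k = v 2) /\
           (~ (n ∈ k /\ k ∈ succ m) -> app u k = v 1)) /\
       (forall k, k ∈ omega -> k <> empty ->
           (n ∈ k /\ k ∈ m -> app s k = v 2) /\
           (~ (n ∈ k /\ k ∈ m) -> app s k = v 1)) /\
       app u empty = app s empty)))
      (e := scons S (scons d (fun _ => e)))).
    + definability.
    + in_class.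
  - apply (class_term (C := M) (t := fun v =>
      sep (prod (v 0) (bigcup (v 0))) (fun p => exists u, u ∈ v 0 /\ exists n, n ∈ omega /\
       p = ⟨u, ⟨n, app u empty⟩⟩ /\
       forall k, k ∈ omega -> k <> empty ->
           (n ∈ k /\ k ∈ succ (succ n) -> app u k = v 2) /\
           (~ (n ∈ k /\ k ∈ succ (succ n)) -> app u k = v 1)))
      (e := scons S (scons d (fun _ => e)))).
    + definability.
    + in_class.
  - intros u s H; apply shift_blockP in H; tauto.
  - intros u z H; apply decode_blockP in H; tauto.
  - intros u s s' H H'; apply shift_blockP in H; apply shift_blockP in H'.
    destruct H as [Hu [Hs [[<- H]|[n [Hn [m [Hm [V [B [Bs E]]]]]]]]]];
    destruct H' as [_ [Hs' [[<- H']|[n' [Hn' [m' [Hm' [V' [B' [Bs' E']]]]]]]]]].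
    + reflexivity.
    (* A sequence that stays in place is not special, whereas one that is shifted carries a block;
       the mixed cases are therefore void. *)
    + destruct H; apply (block_special Hn' (omegaS Hm')); auto; apply succP; auto.
    + destruct H'; apply (block_special Hn (omegaS Hm)); auto; apply succP; auto.
    + destruct (block_inj (u := u) (n := n) (m := succ m) (n' := n') (m' := succ m'))
        as [<- Em]; auto using omegaS; try (apply succP; auto).
      apply succ_inj in Em; subst m'.
      apply (block_unique (n := n) (m := m)); auto; congruence.
  - intros u z z' H H'; apply decode_blockP in H; apply decode_blockP in H'.
    destruct H as [Hu [_ [n [Hn [-> B]]]]]; destruct H' as [_ [_ [n' [Hn' [-> B']]]]].
    destruct (block_inj (u := u) (n := n) (m := succ (succ n)) (n' := n')
      (m' := succ (succ n'))) as [<- _]; auto using omegaS, mem_succ.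
  - intros u s z H H'; apply shift_blockP in H; apply decode_blockP in H'.
    destruct H' as [_ [_ [n' [Hn' [-> B']]]]].
    destruct H as [Hu [Hs [[<- H]|[n [Hn [m [Hm [V [B [Bs E]]]]]]]]]].
    + apply H; apply (block_special Hn' (omegaS (omegaS Hn'))); auto using mem_succ.
    (* Equality of the blocks gives [m = succ n], which contradicts [succ n ∈ m]: the shift never
       uses a block of length one. *)
    + destruct (block_inj (u := u) (n := n) (m := succ m) (n' := n')
        (m' := succ (succ n'))) as [<- Em]; auto using omegaS, mem_succ;
        try (apply succP; auto).
      apply succ_inj in Em; subst m; exact (mem_irrefl V).
  (* A special [s] is reached from the sequence with the same value at 0 and a run one place longer;
     any other [s] is reached from itself. *)
  - intros s Hs; destruct (classic (special s)) as [[n [Hn [m [Hm [V B]]]]]|H].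
    + destruct (block_S (b := app s empty) (n := n) (m := succ m)) as [u [Hu [E Bu]]];
        auto using omegaS.
      { apply (app_in (fun_S Hs) omega0). }
      exists u; apply shift_blockP; repeat split; auto; right; eauto 10.
    + exists s; apply shift_blockP; auto.
  - intros z Hz; pose proof Hz as Hz'; apply bigcupP in Hz'; destruct Hz' as [s [Hs Hzs]].
    pose proof (proj1 (fun_S Hs) z Hzs) as Hp; apply prodP in Hp.
    destruct Hp as [n [Hn [b [Hb ->]]]].
    destruct (block_S (b := b) (n := n) (m := succ (succ n))) as [u [Hu [E Bu]]];
      auto using omegaS.
    exists u; apply decode_blockP; repeat split; auto; exists n; rewrite E; auto.
Qed.

End Coding.

(** * Permutations and names *)

Section Names.
Context {U : Universe} (V : U -> Prop) (w1 G : U).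
Hypothesis Vt : transitive_class V.
Hypothesis Vz : ZF V.
Hypothesis Vw : V w1.
Hypothesis HG : generic V w1 G.
Implicit Types x y z a b p q r pi rho f g h k n : U.

Lemma class_contains_empty : V empty.
Proof. apply (class_empty Vt Vz Vw). Qed.

Lemma cond_empty : cond V w1 empty.
Proof.
  repeat split.
  - apply class_contains_empty.
  - exists nil; intros z; split; [intros H; destruct (emptyP H)|intros []].
  - intros z H; destruct (emptyP H).
  - intros x i j H; destruct (emptyP H).
Qed.

Definition point a n : U := upair ⟨⟨a, n⟩, succ empty⟩ ⟨⟨a, n⟩, succ empty⟩.

Lemma cond_point a n : a ∈ w1 -> n ∈ omega -> cond V w1 (point a n).
Proof.
  intros Ha Hn; repeat split.
  - apply (class_term (C := V)
      (t := fun e => upair ⟨⟨e 0, e 1⟩, succ empty⟩ ⟨⟨e 0, e 1⟩, succ empty⟩)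
      (e := scons a (fun _ => n))); [definability|].
    in_class; [exact (Vt Vw Ha)|intros _; exact (Vt (class_omega Vt Vz) Hn)].
  - exists (cons ⟨⟨a, n⟩, succ empty⟩ nil); intros z; unfold point; rewrite singP; simpl.
    intuition.
  - intros z Hz; apply singP in Hz; subst z; apply mem_prod; split.
    + apply mem_prod; auto.
    + apply upairP; auto.
  - intros x i j Hi Hj; apply singP in Hi; apply singP in Hj.
    apply opair_inj in Hi; apply opair_inj in Hj; destruct Hi, Hj; congruence.
Qed.

Lemma generic_empty : empty ∈ G.
Proof.
  destruct HG as [_ [[p Hp] [Hup _]]]; apply (Hup empty p cond_empty Hp).
  intros z Hz; destruct (emptyP Hz).
Qed.

(** The filter contains every condition weaker than one of its members, so a condition witnessing
    [n] can be cut down to a single point. This lets the name of a real use one-point conditions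
    only. *)
Lemma cohen_realP a n : a ∈ w1 -> n ∈ omega -> (n ∈ cohen_real G a <-> point a n ∈ G).
Proof.
  intros Ha Hn; unfold cohen_real; rewrite sepP; split.
  - intros [_ [p [Hp H]]]; destruct HG as [_ [_ [Hup _]]].
    apply (Hup _ p (cond_point Ha Hn) Hp).
    intros z Hz; apply singP in Hz; subst z; exact H.
  - intros H; split; [exact Hn|]; exists (point a n); split; [exact H|]; apply singP; auto.
Qed.

(** * Permutations of [w1] and their action on conditions and names *)

Lemma perm_app pi a : perm V w1 pi -> a ∈ w1 -> app pi a ∈ w1.
Proof. intros [_ [[Hf _] _]]; apply (app_in Hf). Qed.

(** The two-sided inverse [K] gives injectivity and surjectivity at once. The identity, inverses and
    composites are all verified in this way. *)
Lemma perm_intro f (F K : U -> U) :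
  V f -> f ⊆ prod w1 w1 -> (forall a b, a ∈ w1 -> (⟨a, b⟩ ∈ f <-> b = F a)) ->
  (forall a, a ∈ w1 -> F a ∈ w1 /\ K a ∈ w1 /\ K (F a) = a /\ F (K a) = a) ->
  perm V w1 f /\ forall a, a ∈ w1 -> app f a = F a.
Proof.
  intros Vf Hf Hgraph HK.
  assert (ff : is_fun f w1 w1).
  { split; [exact Hf|]; intros a Ha; exists (F a); split; [apply Hgraph; auto|].
    intros b Hb; apply Hgraph in Hb; auto. }
  assert (fE : forall a, a ∈ w1 -> app f a = F a).
  { intros a Ha; apply (fun_app ff), Hgraph; auto. }
  split; [|exact fE]; split; [exact Vf|]; repeat split; try apply ff.
  - intros a b Ha Hb; rewrite !fE; auto; intros E.
    rewrite <- (proj1 (proj2 (proj2 (HK a Ha)))), E; apply HK, Hb.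
  - intros b Hb; exists (K b); destruct (HK b Hb) as [H1 [H2 [H3 H4]]].
    split; [exact H2|]; rewrite fE; auto.
Qed.

Lemma perm_idP : perm V w1 (perm_id w1) /\ forall a, a ∈ w1 -> app (perm_id w1) a = a.
Proof.
  apply perm_intro with (K := fun a => a).
  (* The definition quantifies over the whole universe; rewriting it with a bound in [w1] gives a
     term definable over [V]. The same is done for inverses and composites. *)
  - replace (perm_id w1) with (repl w1 (fun a => ⟨a, a⟩)).
    + apply (class_term (C := V) (t := fun e => repl (e 0) (fun a => ⟨a, a⟩))
        (e := fun _ => w1)); [definability|in_class].
    + apply mem_ext; intros z; rewrite replP; unfold perm_id; rewrite sepP; split.
      * intros [a [Ha ->]]; split; [apply mem_prod; auto|eauto].
      * intros [Hz [a ->]]; apply mem_prod in Hz; exists a; tauto.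
  - intros z Hz; apply sepP in Hz; apply Hz.
  - intros a b Ha; unfold perm_id; rewrite sepP; split.
    + intros [_ [a' E]]; apply opair_inj in E; destruct E; congruence.
    + intros ->; split; [apply mem_prod; auto|eauto].
  - auto.
Qed.

Lemma mem_perm_inv pi a b : perm V w1 pi -> (⟨b, a⟩ ∈ perm_inv w1 pi <-> ⟨a, b⟩ ∈ pi).
Proof.
  intros [_ [[Hf _] _]]; unfold perm_inv; rewrite sepP; split.
  - intros [_ [a' [b' [E H]]]]; apply opair_inj in E; destruct E; subst; auto.
  - intros H; split; [|eauto]; apply mem_prod; pose proof (fun_dom Hf H); tauto.
Qed.

Lemma perm_invK pi a : perm V w1 pi -> a ∈ w1 -> app (perm_inv w1 pi) (app pi a) = a.
Proof.
  intros Hpi Ha; pose proof Hpi as [_ [[Hf Hinj] _]]; apply app_unique.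
  - apply mem_perm_inv; [exact Hpi|]; exact (app_mem Hf Ha).
  - intros b Hb; rewrite mem_perm_inv in Hb; [|exact Hpi].
    apply Hinj; [apply (fun_dom Hf Hb)|exact Ha|exact (fun_app Hf Hb)].
Qed.

Lemma perm_invP pi : perm V w1 pi ->
  perm V w1 (perm_inv w1 pi) /\
  forall a, a ∈ w1 -> app pi (app (perm_inv w1 pi) a) = a /\ app (perm_inv w1 pi) a ∈ w1.
Proof.
  intros Hpi; pose proof Hpi as [Vpi [[Hf Hinj] [_ Hsur]]].
  assert (HK : forall a, a ∈ w1 ->
    app pi (app (perm_inv w1 pi) a) = a /\ app (perm_inv w1 pi) a ∈ w1).
  { intros a Ha; destruct (Hsur a Ha) as [b [Hb <-]]; rewrite perm_invK; auto. }
  split; [|exact HK].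
  apply (perm_intro (F := app (perm_inv w1 pi)) (K := app pi)).
  - replace (perm_inv w1 pi) with (sep (prod w1 w1)
      (fun z => exists a, a ∈ w1 /\ exists b, b ∈ w1 /\ z = ⟨b, a⟩ /\ ⟨a, b⟩ ∈ pi)).
    + apply (class_term (C := V) (t := fun e => sep (prod (e 0) (e 0))
        (fun z => exists a, a ∈ e 0 /\ exists b, b ∈ e 0 /\ z = ⟨b, a⟩ /\ ⟨a, b⟩ ∈ e 1))
        (e := scons w1 (fun _ => pi))); [definability|in_class].
    + apply mem_ext; intros z; unfold perm_inv; rewrite !sepP; split.
      * intros [Hz [a [_ [b [_ H]]]]]; eauto.
      * intros [Hz [a [b [-> H]]]]; split; [exact Hz|].
        apply mem_prod in Hz; exists a; split; [tauto|]; exists b; tauto.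
  - intros z Hz; apply sepP in Hz; apply Hz.
  - intros a b Ha; rewrite mem_perm_inv; auto; split.
    + intros H; rewrite <- (fun_app Hf H), perm_invK; auto; apply (fun_dom Hf H).
    + intros ->; destruct (HK a Ha) as [E H]; rewrite <- E at 2; exact (app_mem Hf H).
  - intros a Ha; destruct (HK a Ha); repeat split; auto using perm_app, perm_invK.
Qed.

Lemma perm_compP pi rho : perm V w1 pi -> perm V w1 rho ->
  perm V w1 (perm_comp w1 pi rho) /\
  forall a, a ∈ w1 -> app (perm_comp w1 pi rho) a = app pi (app rho a).
Proof.
  intros Hpi Hrho.
  apply perm_intro with (K := fun a => app (perm_inv w1 rho) (app (perm_inv w1 pi) a)).
  - replace (perm_comp w1 pi rho) with (repl w1 (fun a => ⟨a, app pi (app rho a)⟩)).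
    + apply (class_term (C := V) (t := fun e => repl (e 0) (fun a => ⟨a, app (e 1) (app (e 2) a)⟩))
        (e := scons w1 (scons pi (fun _ => rho)))); [definability|].
      in_class; [apply Hpi|intros _; apply Hrho].
    + apply mem_ext; intros z; rewrite replP; unfold perm_comp; rewrite sepP; split.
      * intros [a [Ha ->]]; split; [apply mem_prod; auto using perm_app|eauto].
      * intros [Hz [a ->]]; apply mem_prod in Hz; exists a; tauto.
  - intros z Hz; apply sepP in Hz; apply Hz.
  - intros a b Ha; unfold perm_comp; rewrite sepP; split.
    + intros [_ [a' E]]; apply opair_inj in E; destruct E; congruence.
    + intros ->; split; [apply mem_prod; auto using perm_app|eauto].
  - intros a Ha; destruct (perm_invP Hpi) as [_ Ip]; destruct (perm_invP Hrho) as [_ Ir].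
    destruct (Ip a Ha) as [E1 H1]; destruct (Ir _ H1) as [E2 H2].
    repeat split; auto using perm_app.
    + rewrite !perm_invK; auto using perm_app.
    + rewrite E2; exact E1.
Qed.

Lemma cond_triple p z : cond V w1 p -> z ∈ p ->
  exists a n i, a ∈ w1 /\ z = ⟨⟨a, n⟩, i⟩.
Proof.
  intros [_ [_ [H _]]] Hz; apply H in Hz; apply prodP in Hz.
  destruct Hz as [t [Ht [i [_ ->]]]]; apply prodP in Ht.
  destruct Ht as [a [Ha [n [_ ->]]]]; eauto 6.
Qed.

Lemma triple_inj a n i a' n' i' :
  ⟨⟨a, n⟩, i⟩ = ⟨⟨a', n'⟩, i'⟩ -> a = a' /\ n = n' /\ i = i'.
Proof.
  intros E; apply opair_inj in E; destruct E as [E ->].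
  apply opair_inj in E; tauto.
Qed.

Lemma cond_first p a n i : cond V w1 p -> ⟨⟨a, n⟩, i⟩ ∈ p -> a ∈ w1.
Proof.
  intros Hp H; destruct (cond_triple Hp H) as [a' [n' [i' [Ha E]]]].
  apply triple_inj in E; destruct E as [-> _]; exact Ha.
Qed.

Lemma act_cond_fixed pi p : cond V w1 p ->
  (forall a n i, ⟨⟨a, n⟩, i⟩ ∈ p -> app pi a = a) -> act_cond pi p p.
Proof.
  intros Hp H z; split.
  - intros Hz; destruct (cond_triple Hp Hz) as [a [n [i [Ha ->]]]].
    exists a, n, i; rewrite (H a n i Hz); auto.
  - intros [a [n [i [Hz ->]]]]; rewrite (H a n i Hz); exact Hz.
Qed.

Lemma act_cond_comp pi rho p q r : perm V w1 pi -> perm V w1 rho -> cond V w1 p ->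
  act_cond rho p q -> act_cond pi q r -> act_cond (perm_comp w1 pi rho) p r.
Proof.
  intros Hpi Hrho Hp H1 H2 z; destruct (perm_compP Hpi Hrho) as [_ E]; rewrite (H2 z); split.
  - intros [b [n [i [Hb ->]]]]; apply H1 in Hb; destruct Hb as [a [n' [i' [Ha Eb]]]].
    apply triple_inj in Eb; destruct Eb as [-> [-> ->]].
    exists a, n', i'; rewrite E; eauto using cond_first.
  - intros [a [n [i [Ha ->]]]]; exists (app rho a), n, i; split.
    + apply H1; eauto 6.
    + rewrite E; eauto using cond_first.
Qed.

Lemma act_cond_inv pi p q : perm V w1 pi -> cond V w1 p ->
  act_cond pi p q -> act_cond (perm_inv w1 pi) q p.
Proof.
  intros Hpi Hp H z; split.
  - intros Hz; destruct (cond_triple Hp Hz) as [a [n [i [Ha ->]]]].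
    exists (app pi a), n, i; rewrite perm_invK; auto; split; [apply H; eauto 6|auto].
  - intros [b [n [i [Hb ->]]]]; apply H in Hb; destruct Hb as [a [n' [i' [Ha E]]]].
    apply triple_inj in E; destruct E as [-> [-> ->]].
    rewrite perm_invK; eauto using cond_first.
Qed.

(** Hereditary names for the forcing, with symmetry forgotten: the group laws of the action are
    proved by induction on this predicate. The last clause has [is_name] directly as its conclusion,
    which yields a usable induction hypothesis. *)
Inductive is_name x : Prop :=
| is_name_intro :
    (forall z, z ∈ x -> exists y p, z = ⟨y, p⟩) ->
    (forall y p, ⟨y, p⟩ ∈ x -> cond V w1 p) ->
    (forall y p, ⟨y, p⟩ ∈ x -> is_name y) ->
    is_name x.

Lemma is_name_of_elements x :
  (forall z, z ∈ x -> exists y p, z = ⟨y, p⟩ /\ cond V w1 p /\ is_name y) -> is_name x.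
Proof.
  intros H; constructor.
  - intros z Hz; destruct (H z Hz) as [y [p [E _]]]; eauto.
  - intros y p Hz; destruct (H _ Hz) as [y' [p' [E [Hp _]]]].
    apply opair_inj in E; destruct E; subst; auto.
  - intros y p Hz; destruct (H _ Hz) as [y' [p' [E [_ Hy]]]].
    apply opair_inj in E; destruct E; subst; auto.
Qed.

Lemma HS_is_name : forall x, HS V w1 x -> is_name x.
Proof.
  (* In [HS] the recursive occurrence is nested under an existential quantifier, so the recursion on
     the derivation is written out. *)
  fix IH 2; intros x [x' _ H _]; apply is_name_of_elements; intros z Hz.
  destruct (H z Hz) as [y [p [E [Hp Hy]]]]; exists y, p; auto.
Qed.

Lemma act_name_id x : is_name x -> act_name (perm_id w1) x x.
Proof.
  induction 1 as [x Hpair Hcond Hname IH].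
  assert (Hfix : forall y p, ⟨y, p⟩ ∈ x -> act_cond (perm_id w1) p p).
  { intros y p Hz; apply act_cond_fixed; [eauto|]; intros a n i Ha.
    apply perm_idP; eauto using cond_first. }
  constructor.
  - intros y p Hz; exists y, p; eauto.
  - intros z Hz; destruct (Hpair z Hz) as [y [p ->]]; exists y, p, y, p; eauto 8.
Qed.

Lemma act_name_comp pi rho x : perm V w1 pi -> perm V w1 rho -> is_name x ->
  forall y z, act_name rho x y -> act_name pi y z -> act_name (perm_comp w1 pi rho) x z.
Proof.
  intros Hpi Hrho; induction 1 as [x Hpair Hcond Hname IH]; intros y z Hxy Hyz.
  destruct Hxy as [x y Hxy Hyx]; destruct Hyz as [y z Hyz Hzy].
  constructor.
  - intros u p Hu; destruct (Hxy u p Hu) as [u' [p' [A1 [B1 Hu']]]].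
    destruct (Hyz u' p' Hu') as [u'' [p'' [A2 [B2 Hu'']]]].
    exists u'', p''; split; [eauto|]; split; [|exact Hu''].
    apply act_cond_comp with p'; eauto.
  - intros w Hw; destruct (Hzy w Hw) as [u' [p' [u'' [p'' [Hu' [A2 [B2 ->]]]]]]].
    destruct (Hyx _ Hu') as [u [p [u1 [p1 [Hu [A1 [B1 E]]]]]]].
    apply opair_inj in E; destruct E; subst u1 p1.
    exists u, p, u'', p''; split; [exact Hu|]; split; [eauto|]; split; [|reflexivity].
    apply act_cond_comp with p'; eauto.
Qed.

Lemma act_name_inv pi x : perm V w1 pi -> is_name x ->
  forall y, act_name pi x y -> act_name (perm_inv w1 pi) y x.
Proof.
  intros Hpi; induction 1 as [x Hpair Hcond Hname IH]; intros y Hxy.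
  destruct Hxy as [x y Hxy Hyx]; constructor.
  - intros u' p' Hu'; destruct (Hyx _ Hu') as [u [p [u1 [p1 [Hu [A1 [B1 E]]]]]]].
    apply opair_inj in E; destruct E; subst u1 p1.
    exists u, p; split; [eauto|]; split; [|exact Hu]; apply act_cond_inv; eauto.
  - intros z Hz; destruct (Hpair z Hz) as [u [p ->]].
    destruct (Hxy u p Hz) as [u' [p' [A1 [B1 Hu']]]].
    exists u', p', u, p; split; [exact Hu'|]; split; [eauto|]; split; [|reflexivity].
    apply act_cond_inv; eauto.
Qed.

(** The filter is upward closed among subgroups only, so this is required before a stabilizer that
    contains a filter member can be placed in the filter. *)
Lemma stabilizer_subgroup x : is_name x -> subgroup V w1 (stabilizer V w1 x).
Proof.
  intros Hx; split; [|split; [|split]].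
  - intros pi H; apply H.
  - split; [apply perm_idP|apply act_name_id, Hx].
  - intros pi rho [Hpi Api] [Hrho Arho]; split; [apply perm_compP; auto|].
    apply act_name_comp with x; auto.
  - intros pi [Hpi Api]; split; [apply perm_invP; auto|apply act_name_inv; auto].
Qed.

Lemma in_filter_stab_point a : a ∈ w1 -> in_filter V w1 (pointwise_stab V w1 (upair a a)).
Proof.
  intros Ha; pose proof (Vt Vw Ha) as Va; apply filter_fix.
  - apply class_upair; auto.
  - intros z Hz; apply singP in Hz; subst; exact Ha.
  - exists (upair ⟨a, empty⟩ ⟨a, empty⟩); split; [|split; [split|]].
    + apply (class_term (C := V) (t := fun e => upair ⟨e 0, empty⟩ ⟨e 0, empty⟩)
        (e := fun _ => a)); [definability|in_class].
    + intros z Hz; apply singP in Hz; subst z; apply mem_prod; split.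
      * apply singP; reflexivity.
      * apply omega0.
    + intros x Hx; apply singP in Hx; subst x; exists empty; split; [apply singP; auto|].
      intros y Hy; apply singP in Hy; apply opair_inj in Hy; symmetry; tauto.
    + intros x y Hx Hy _; apply singP in Hx; apply singP in Hy; congruence.
Qed.

(* Up to [n], [h] is the recursion k ↦ {⟨h(j), ∅⟩ : j < k} for the canonical names. *)
Definition check_upto h n : Prop :=
  forall k, k ∈ succ n -> app h k = repl k (fun j => ⟨app h j, empty⟩).

(** The recursion equation determines each value from the earlier ones, so approximations of
    different lengths agree on their common part and can be glued. *)
Lemma check_upto_unique n h n' h' : n ∈ omega -> n' ∈ omega ->
  check_upto h n -> check_upto h' n' ->
  forall k, k ∈ succ n -> k ∈ succ n' -> app h k = app h' k.
Proof.
  intros Hn Hn' H H' k; induction k as [k IH] using mem_induction; intros Hk Hk'.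
  rewrite (H k Hk), (H' k Hk'); apply repl_ext; intros j Hj.
  rewrite IH; auto; [apply (nat_trans (omegaS Hn) Hk Hj)|apply (nat_trans (omegaS Hn') Hk' Hj)].
Qed.

Lemma check_upto_exists n : n ∈ omega -> exists h, V h /\ check_upto h n.
Proof.
  revert n; apply omega_ind.
  - (* Outside the domain of a function, [app] takes the value [empty]. *)
    exists empty; split; [apply class_contains_empty|]; intros k Hk; apply succP in Hk.
    destruct Hk as [Hk| ->]; [destruct (emptyP Hk)|].
    apply mem_ext; intros z; split; intros Hz.
    + unfold app in Hz; apply bigcupP in Hz; destruct Hz as [w [Hw _]].
      apply sepP in Hw; destruct (emptyP (proj2 Hw)).
    + apply replP in Hz; destruct Hz as [j [Hj _]]; destruct (emptyP Hj).
  - intros n Hn [h [Vh Hh]].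
    (* The recursion step is applied to [h] at all places up to [succ n] at once. At places up to
       [n] this reproduces the values of [h], so only the last value is new. *)
    set (h' := repl (succ (succ n)) (fun k => ⟨k, repl k (fun j => ⟨app h j, empty⟩)⟩)).
    exists h'; split.
    + apply (class_term (C := V) (t := fun e => repl (succ (succ (e 0)))
        (fun k => ⟨k, repl k (fun j => ⟨app (e 1) j, empty⟩)⟩))
        (e := scons n (fun _ => h))); [definability|].
      in_class; exact (Vt (class_omega Vt Vz) Hn).
    + assert (E : forall k, k ∈ succ (succ n) ->
        app h' k = repl k (fun j => ⟨app h j, empty⟩)).
      { intros k Hk; apply (app_repl (fun k => repl k (fun j => ⟨app h j, empty⟩)) Hk). }
      intros k Hk; rewrite (E k Hk); apply repl_ext; intros j Hj.
      assert (Hj' : j ∈ succ n).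
      { apply succP in Hk; destruct Hk as [Hk| ->]; [|exact Hj].
        exact (nat_trans (omegaS Hn) Hk Hj). }
      rewrite (E j); [|apply succP; auto]; rewrite (Hh j Hj'); reflexivity.
Qed.

(** Recursion on [omega] inside [V]: replacement collects the values of the finite approximations.
    The names of reals and sequences are formed by replacement along [omega] in [V], which requires
    all canonical names to come from one function in [V]. *)
Lemma check_exists :
  exists h, V h /\ forall n, n ∈ omega -> app h n = repl n (fun j => ⟨app h j, empty⟩).
Proof.
  assert (VO : V omega) by (apply class_omega; assumption).
  destruct (class_replacement Vt Vz
    (P := fun e => exists h, V h /\
       ((forall k, k ∈ succ (e 0) -> app h k = repl k (fun j => ⟨app h j, empty⟩)) /\
       e 1 = ⟨e 0, app h (e 0)⟩)) (e := fun _ => omega) (a := omega)) as [b [Vb Hb]].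
  - definability.
  - in_class.
  - exact VO.
  - intros n Hn; destruct (check_upto_exists Hn) as [h [Vh Hh]].
    exists ⟨n, app h n⟩; split.
    + split; [|exists h; auto].
      apply (class_term (C := V) (t := fun e => ⟨e 0, app (e 1) (e 0)⟩)
        (e := scons n (fun _ => h))); [definability|].
      in_class; exact (Vt VO Hn).
    + intros y [_ [h' [_ [Hh' E]]]]; cbn in E, Hh'; subst y.
      rewrite (check_upto_unique Hn Hn Hh Hh' (mem_succ n) (mem_succ n)); reflexivity.
  - cbn in Hb; assert (E : forall n h, n ∈ omega -> V h -> check_upto h n -> app b n = app h n).
    { intros n h Hn Vh Hh; apply app_unique.
      - apply Hb; split; [|exists n; split; [exact Hn|]; exists h; auto].
        apply (class_term (C := V) (t := fun e => ⟨e 0, app (e 1) (e 0)⟩)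
          (e := scons n (fun _ => h))); [definability|].
        in_class; exact (Vt VO Hn).
      - intros y Hy; apply Hb in Hy; destruct Hy as [_ [n' [Hn' [h' [_ [Hh' E]]]]]].
        apply opair_inj in E; destruct E as [<- ->].
        exact (check_upto_unique Hn Hn Hh' Hh (mem_succ n) (mem_succ n)). }
    exists b; split; [exact Vb|]; intros n Hn.
    destruct (check_upto_exists Hn) as [h [Vh Hh]].
    rewrite (E n h Hn Vh Hh), (Hh n (mem_succ n)); apply repl_ext; intros j Hj.
    rewrite (E j h); auto; [exact (omega_trans Hn Hj)|].
    intros k Hk; apply Hh, succP; left; apply succP in Hk; destruct Hk as [Hk| ->]; auto.
    exact (nat_trans Hn Hj Hk).
Qed.

End Names.

(** * Symmetric names for block sequences *)

Section SymmetricNames.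
Context {U : Universe} (V : U -> Prop) (w1 G : U).
Hypothesis Vt : transitive_class V.
Hypothesis Vz : ZF V.
Hypothesis Vw : V w1.
Hypothesis HG : generic V w1 G.
Variables b0 d0 e0 : U.
Hypothesis Hb : b0 ∈ w1.
Hypothesis Hd : d0 ∈ w1.
Hypothesis He : e0 ∈ w1.
Variable h : U.
Hypothesis Vh : V h.
Hypothesis Hh : forall n : U, n ∈ omega -> app h n = repl n (fun j => ⟨app h j, empty⟩).
Implicit Types x y z a p pi k n m : U.

(** Written as an intersection of one-point stabilizers, so that closure of the filter under
    intersections applies, whatever coincidences there are among the three points. *)
Definition fixing pi : Prop :=
  (pointwise_stab V w1 (upair b0 b0) pi /\ pointwise_stab V w1 (upair d0 d0) pi) /\
  pointwise_stab V w1 (upair e0 e0) pi.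

Lemma in_filter_fixing : in_filter V w1 fixing.
Proof.
  apply filter_cap; [apply filter_cap|]; apply in_filter_stab_point; assumption.
Qed.

Lemma fixing_perm pi : fixing pi -> perm V w1 pi.
Proof. intros [_ [H _]]; exact H. Qed.

Definition fixed_point a : Prop := a ∈ w1 /\ forall pi, fixing pi -> app pi a = a.

Lemma fixed_b : fixed_point b0.
Proof. split; [exact Hb|]; intros pi [[[_ H] _] _]; apply H, singP; reflexivity. Qed.

Lemma fixed_d : fixed_point d0.
Proof. split; [exact Hd|]; intros pi [[_ [_ H]] _]; apply H, singP; reflexivity. Qed.

Lemma fixed_e : fixed_point e0.
Proof. split; [exact He|]; intros pi [_ [_ H]]; apply H, singP; reflexivity. Qed.

Definition fixed_name x : Prop :=
  HS V w1 x /\ forall pi, fixing pi -> act_name pi x x.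

Definition fixed_cond p : Prop :=
  cond V w1 p /\ forall pi, fixing pi -> act_cond pi p p.

(** A permutation that fixes every name and every condition occurring in [x] fixes [x]. Hence the
    stabilizer of [x] contains the group [fixing] and, being a subgroup, lies in the filter. With
    one group serving all subnames, symmetry is checked only here. *)
Lemma fixed_name_intro x : V x ->
  (forall z, z ∈ x -> exists y p, z = ⟨y, p⟩ /\ fixed_name y /\ fixed_cond p) ->
  fixed_name x.
Proof.
  intros Vx H.
  assert (Hact : forall pi, fixing pi -> act_name pi x x).
  { intros pi Hpi; constructor.
    - intros y p Hz; exists y, p; destruct (H _ Hz) as [y' [p' [E [Hy Hp]]]].
      apply opair_inj in E; destruct E; subst y' p'.
      split; [apply Hy, Hpi|]; split; [apply Hp, Hpi|exact Hz].
    - intros z Hz; destruct (H z Hz) as [y [p [-> [Hy Hp]]]]; exists y, p, y, p.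
      split; [exact Hz|]; split; [apply Hy, Hpi|]; split; [apply Hp, Hpi|reflexivity]. }
  split; [|exact Hact]; apply HS_intro.
  - exact Vx.
  - intros z Hz; destruct (H z Hz) as [y [p [E [Hy Hp]]]]; exists y, p.
    split; [exact E|]; split; [apply Hp|apply Hy].
  - apply (filter_up in_filter_fixing).
    + apply stabilizer_subgroup; auto; apply is_name_of_elements; intros z Hz.
      destruct (H z Hz) as [y [p [E [Hy Hp]]]]; exists y, p.
      split; [exact E|]; split; [apply Hp|apply HS_is_name, Hy].
    + intros pi Hpi; split; [apply fixing_perm|]; auto.
Qed.

Lemma fixed_empty : fixed_cond empty.
Proof.
  pose proof (cond_empty Vt Vz Vw) as H; split; [exact H|]; intros pi _.
  apply (act_cond_fixed H); intros a n i Hz; destruct (emptyP Hz).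
Qed.

Lemma fixed_cond_point a n : fixed_point a -> n ∈ omega -> fixed_cond (point a n).
Proof.
  intros [Ha Hfix] Hn; pose proof (cond_point Vt Vz Vw Ha Hn) as H; split; [exact H|].
  intros pi Hpi; apply (act_cond_fixed H); intros a' n' i Hz; apply singP in Hz.
  apply triple_inj in Hz; destruct Hz as [-> _]; auto.
Qed.

Lemma V_omega : V omega.
Proof. apply class_omega; assumption. Qed.

Lemma V_nat n : n ∈ omega -> V n.
Proof. intros Hn; exact (Vt V_omega Hn). Qed.

Lemma fixed_check n : n ∈ omega -> fixed_name (app h n).
Proof.
  induction n as [n IH] using mem_induction; intros Hn; apply fixed_name_intro.
  - apply (class_term (C := V) (t := fun e => app (e 0) (e 1)) (e := scons h (fun _ => n)));
      [definability|]; in_class; intros _; apply V_nat, Hn.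
  - intros z Hz; rewrite (Hh Hn) in Hz; apply replP in Hz; destruct Hz as [j [Hj ->]].
    exists (app h j), empty; split; [reflexivity|]; split; [|apply fixed_empty].
    apply IH; [exact Hj|exact (omega_trans Hn Hj)].
Qed.

Lemma evaluates_check n : n ∈ omega -> evaluates G (app h n) n.
Proof.
  induction n as [n IH] using mem_induction; intros Hn; rewrite (Hh Hn); constructor.
  - intros y p Hz _; apply replP in Hz; destruct Hz as [j [Hj E]].
    apply opair_inj in E; destruct E as [-> ->]; exists j; split; [exact Hj|].
    apply IH; [exact Hj|exact (omega_trans Hn Hj)].
  - intros j Hj; exists (app h j), empty; split; [apply replP; eauto|].
    split; [apply (generic_empty Vt Vz Vw HG)|].
    apply IH; [exact Hj|exact (omega_trans Hn Hj)].
Qed.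

(** * Names for Cohen reals, pairs and constant functions *)

Definition real_name a : U := repl omega (fun n => ⟨app h n, point a n⟩).

Lemma fixed_real_name a : fixed_point a -> fixed_name (real_name a).
Proof.
  intros Ha; apply fixed_name_intro.
  - apply (class_term (C := V) (t := fun e => repl omega (fun n => ⟨app (e 0) n,
      upair ⟨⟨e 1, n⟩, succ empty⟩ ⟨⟨e 1, n⟩, succ empty⟩⟩)) (e := scons h (fun _ => a)));
      [definability|]; in_class; intros _; exact (Vt Vw (proj1 Ha)).
  - intros z Hz; apply replP in Hz; destruct Hz as [n [Hn ->]].
    exists (app h n), (point a n); split; [reflexivity|].
    split; [apply fixed_check, Hn|apply fixed_cond_point; assumption].
Qed.

Lemma evaluates_real_name a : a ∈ w1 -> evaluates G (real_name a) (cohen_real G a).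
Proof.
  intros Ha; constructor.
  - intros y p Hz Hp; apply replP in Hz; destruct Hz as [n [Hn E]].
    apply opair_inj in E; destruct E as [-> ->]; exists n.
    split; [apply (cohen_realP Vt Vz Vw HG Ha Hn), Hp|apply evaluates_check, Hn].
  - intros n Hn; assert (Hn' : n ∈ omega) by (apply sepP in Hn; apply Hn).
    exists (app h n), (point a n); split; [apply replP; eauto|].
    split; [apply (cohen_realP Vt Vz Vw HG Ha Hn'), Hn|apply evaluates_check, Hn'].
Qed.

Definition upair_name x y : U := upair ⟨x, empty⟩ ⟨y, empty⟩.

Lemma fixed_upair_name x y : fixed_name x -> fixed_name y -> fixed_name (upair_name x y).
Proof.
  intros Hx Hy; apply fixed_name_intro.
  - apply (class_term (C := V) (t := fun e => upair ⟨e 0, empty⟩ ⟨e 1, empty⟩)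
      (e := scons x (fun _ => y))); [definability|].
    destruct Hx as [[] _], Hy as [[] _]; in_class.
  - intros z Hz; apply upairP in Hz; destruct Hz; subst z; [exists x|exists y];
      exists empty; auto using fixed_empty.
Qed.

Lemma evaluates_upair_name x y v w :
  evaluates G x v -> evaluates G y w -> evaluates G (upair_name x y) (upair v w).
Proof.
  intros Hx Hy; constructor.
  - intros t p Ht _; apply upairP in Ht; destruct Ht as [E|E];
      apply opair_inj in E; destruct E; subst; [exists v|exists w]; rewrite upairP; auto.
  - intros t Ht; apply upairP in Ht; destruct Ht; subst t; [exists x|exists y];
      exists empty; (split; [apply upairP; auto|]);
      split; auto; apply (generic_empty Vt Vz Vw HG).
Qed.

Definition opair_name x y : U := upair_name (upair_name x x) (upair_name x y).

Lemma fixed_opair_name x y : fixed_name x -> fixed_name y -> fixed_name (opair_name x y).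
Proof. intros; unfold opair_name; auto using fixed_upair_name. Qed.

Lemma evaluates_opair_name x y v w :
  evaluates G x v -> evaluates G y w -> evaluates G (opair_name x y) ⟨v, w⟩.
Proof. intros; unfold opair_name, opair; auto using evaluates_upair_name. Qed.

(** For a set [I] of natural numbers this names the function on [I] with constant value
    [cohen_real G a]. A block sequence is glued from three such pieces. *)
Definition graph_name a (I : U) : U :=
  repl I (fun k => ⟨opair_name (app h k) (real_name a), empty⟩).

Definition graph_value a (I : U) : U := repl I (fun k => ⟨k, cohen_real G a⟩).

Lemma V_graph_name a I : a ∈ w1 -> V I -> V (graph_name a I).
Proof.
  intros Ha VI; apply (class_term (C := V) (t := fun e => repl (e 0) (fun k =>
    ⟨upair ⟨upair ⟨app (e 1) k, empty⟩ ⟨app (e 1) k, empty⟩, empty⟩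
           ⟨upair ⟨app (e 1) k, empty⟩ ⟨repl omega (fun n => ⟨app (e 1) n,
              upair ⟨⟨e 2, n⟩, succ empty⟩ ⟨⟨e 2, n⟩, succ empty⟩⟩), empty⟩, empty⟩, empty⟩))
    (e := scons I (scons h (fun _ => a)))); [definability|].
  in_class; intros _; exact (Vt Vw Ha).
Qed.

Lemma evaluates_graph_name a I :
  a ∈ w1 -> I ⊆ omega -> evaluates G (graph_name a I) (graph_value a I).
Proof.
  intros Ha HI.
  assert (H : forall k, k ∈ I ->
    evaluates G (opair_name (app h k) (real_name a)) ⟨k, cohen_real G a⟩).
  { intros k Hk; apply evaluates_opair_name;
      [apply evaluates_check, HI, Hk|apply evaluates_real_name, Ha]. }
  constructor.
  - intros y p Hz _; apply replP in Hz; destruct Hz as [k [Hk E]].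
    apply opair_inj in E; destruct E as [-> ->]; exists ⟨k, cohen_real G a⟩.
    split; [apply replP; eauto|auto].
  - intros z Hz; apply replP in Hz; destruct Hz as [k [Hk ->]].
    exists (opair_name (app h k) (real_name a)), empty; split; [apply replP; eauto|].
    split; [apply (generic_empty Vt Vz Vw HG)|auto].
Qed.

Lemma evaluates_cup x y v w :
  evaluates G x v -> evaluates G y w -> evaluates G (cup x y) (cup v w).
Proof.
  intros [x' v' H1 H2] [y' w' H3 H4]; constructor.
  - intros z p Hz Hp; apply cupP in Hz; destruct Hz as [Hz|Hz].
    + destruct (H1 z p Hz Hp) as [t [Ht E]]; exists t; rewrite cupP; auto.
    + destruct (H3 z p Hz Hp) as [t [Ht E]]; exists t; rewrite cupP; auto.
  - intros t Ht; apply cupP in Ht; destruct Ht as [Ht|Ht].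
    + destruct (H2 t Ht) as [z [p [Hz E]]]; exists z, p; rewrite cupP; auto.
    + destruct (H4 t Ht) as [z [p [Hz E]]]; exists z, p; rewrite cupP; auto.
Qed.

(** * The name of a block sequence and its value *)

Variables n0 m0 : U.
Hypothesis Hn0 : n0 ∈ omega.
Hypothesis Hm0 : m0 ∈ omega.

Definition inside : U := sep omega (fun k => k <> empty /\ n0 ∈ k /\ k ∈ m0).
Definition outside : U := sep omega (fun k => k <> empty /\ ~ (n0 ∈ k /\ k ∈ m0)).
(** The index sets partition [omega]: [succ empty] is {0}, and [inside] and [outside] divide the
    positive places. *)
Definition block_name : U :=
  cup (graph_name b0 (succ empty)) (cup (graph_name e0 inside) (graph_name d0 outside)).
Definition block_value : U :=
  cup (graph_value b0 (succ empty)) (cup (graph_value e0 inside) (graph_value d0 outside)).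

Lemma V_inside : V inside.
Proof.
  apply (class_term (C := V) (t := fun e => sep omega (fun k => k <> empty /\ e 0 ∈ k /\ k ∈ e 1))
    (e := scons n0 (fun _ => m0))); [definability|].
  in_class; [|intros _]; apply V_nat; assumption.
Qed.

Lemma V_outside : V outside.
Proof.
  apply (class_term (C := V)
    (t := fun e => sep omega (fun k => k <> empty /\ ~ (e 0 ∈ k /\ k ∈ e 1)))
    (e := scons n0 (fun _ => m0))); [definability|].
  in_class; [|intros _]; apply V_nat; assumption.
Qed.

Lemma succ_empty_omega : succ empty ⊆ (omega : U).
Proof. intros k Hk; exact (omega_trans (omegaS omega0) Hk). Qed.

(** The name is assembled from canonical names of natural numbers, names of the reals at the three
    fixed points, and the empty condition; all of these are fixed by the group [fixing]. The index
    sets lie in [V] because [n0] and [m0] do. *)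
Lemma symmetric_block : symmetric_model V w1 G block_value.
Proof.
  exists block_name; split.
  - apply fixed_name_intro.
    + apply (class_term (C := V) (t := fun e => cup (e 0) (cup (e 1) (e 2)))
        (e := scons (graph_name b0 (succ empty)) (scons (graph_name e0 inside)
          (fun _ => graph_name d0 outside)))); [definability|].
      in_class; [| |intros _]; apply V_graph_name; auto using V_inside, V_outside.
      apply V_nat, omegaS, omega0.
    + assert (H : forall a I, fixed_point a -> I ⊆ omega -> forall z, z ∈ graph_name a I ->
        exists y p, z = ⟨y, p⟩ /\ fixed_name y /\ fixed_cond p).
      { intros a I Ha HI z Hz; apply replP in Hz; destruct Hz as [k [Hk ->]].
        exists (opair_name (app h k) (real_name a)), empty; split; [reflexivity|].
        split; [|apply fixed_empty].
        apply fixed_opair_name; [apply fixed_check, HI, Hk|apply fixed_real_name, Ha]. }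
      intros z Hz; apply cupP in Hz; destruct Hz as [Hz|Hz]; [|apply cupP in Hz; destruct Hz as [Hz|Hz]].
      * apply (H b0 (succ empty)); [apply fixed_b|apply succ_empty_omega|exact Hz].
      * apply (H e0 inside); [apply fixed_e| |exact Hz].
        intros k Hk; apply sepP in Hk; apply Hk.
      * apply (H d0 outside); [apply fixed_d| |exact Hz].
        intros k Hk; apply sepP in Hk; apply Hk.
  - unfold block_name, block_value; repeat apply evaluates_cup; apply evaluates_graph_name;
      auto using succ_empty_omega; intros k Hk; apply sepP in Hk; apply Hk.
Qed.

Lemma mem_graph_value a I k v : ⟨k, v⟩ ∈ graph_value a I <-> k ∈ I /\ v = cohen_real G a.
Proof.
  unfold graph_value; rewrite replP; split.
  - intros [k' [Hk E]]; apply opair_inj in E; destruct E; subst; auto.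
  - intros [Hk ->]; eauto.
Qed.

Lemma block_valueP k v : ⟨k, v⟩ ∈ block_value <->
  (k = empty /\ v = cohen_real G b0) \/
  (k ∈ inside /\ v = cohen_real G e0) \/ (k ∈ outside /\ v = cohen_real G d0).
Proof.
  unfold block_value; rewrite !cupP, !mem_graph_value, succP.
  split; [|tauto]; intros [[[H|H] E]|H]; auto; destruct (emptyP H).
Qed.

Lemma block_value_fun : is_fun block_value omega (cohen_set w1 G).
Proof.
  assert (HA : forall a, a ∈ w1 -> cohen_real G a ∈ cohen_set w1 G)
    by (intros a Ha; apply replP; eauto).
  split.
  - intros z Hz.
    assert (H : exists a I, a ∈ w1 /\ I ⊆ omega /\ z ∈ graph_value a I).
    { apply cupP in Hz; destruct Hz as [Hz|Hz]; [|apply cupP in Hz; destruct Hz as [Hz|Hz]].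
      - exists b0, (succ empty); auto using succ_empty_omega.
      - exists e0, inside; repeat split; auto; intros k Hk; apply sepP in Hk; apply Hk.
      - exists d0, outside; repeat split; auto; intros k Hk; apply sepP in Hk; apply Hk. }
    destruct H as [a [I [Ha [HI H]]]]; apply replP in H; destruct H as [k [Hk ->]].
    apply mem_prod; auto.
  - intros k Hk; destruct (classic (k = empty)) as [E|Hk0];
      [|destruct (classic (n0 ∈ k /\ k ∈ m0)) as [E|E]].
    + exists (cohen_real G b0); split; [apply block_valueP; auto|].
      intros v Hv; apply block_valueP in Hv; destruct Hv as [[_ ->]|[[H _]|[H _]]]; auto;
        apply sepP in H; tauto.
    + exists (cohen_real G e0); split.
      * apply block_valueP; right; left; split; [apply sepP|]; auto.
      * intros v Hv; apply block_valueP in Hv.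
        destruct Hv as [[H _]|[[_ ->]|[H _]]]; auto; [contradiction|].
        apply sepP in H; tauto.
    + exists (cohen_real G d0); split.
      * apply block_valueP; right; right; split; [apply sepP|]; auto.
      * intros v Hv; apply block_valueP in Hv.
        destruct Hv as [[H _]|[[H _]|[_ ->]]]; auto; [contradiction|].
        apply sepP in H; tauto.
Qed.

Lemma block_value_sequence : block_value ∈ cohen_sequences V w1 G.
Proof.
  apply sepP; split; [|split; [apply block_value_fun|apply symmetric_block]].
  apply powerP; apply block_value_fun.
Qed.

Lemma block_value_block :
  app block_value empty = cohen_real G b0 /\
  block (cohen_real G d0) (cohen_real G e0) block_value n0 m0.
Proof.
  split; [apply (fun_app block_value_fun), block_valueP; auto|].
  intros k Hk Hk0; split; intros H; apply (fun_app block_value_fun), block_valueP; right;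
    [left|right]; (split; [apply sepP|]); auto.
Qed.

End SymmetricNames.

Theorem mainTheorem4 (U : Universe) (V : U -> Prop) (w1 G : U) (M : U -> Prop)
  (V_trans : transitive_class V) (V_ZF : ZF V) (V_AC : AC V)
  (w1_omega1 : is_omega1 V w1) (G_generic : generic V w1 G)
  (M_trans : transitive_class M) (M_ZF : ZF M)
  (S_in_M : M (cohen_sequences V w1 G)) :
  (PPsplit M (cohen_sequences V w1 G) ->
     well_orderable_in M (cohen_sequences V w1 G)) /\
  (PPsplit M (cohen_sequences V w1 G) -> SVC M (cohen_sequences V w1 G) ->
     AC M).
Proof.
  assert (WO : PPsplit M (cohen_sequences V w1 G) ->
     well_orderable_in M (cohen_sequences V w1 G)).
  { intros HPP; set (S := cohen_sequences V w1 G) in *.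
    assert (fun_S : forall s, s ∈ S -> is_fun s omega (cohen_set w1 G))
      by (intros s Hs; apply sepP in Hs; apply Hs).
    destruct (classic (exists d e, d ∈ cohen_set w1 G /\ e ∈ cohen_set w1 G /\ d <> e))
      as [[d [e [Hd [He Hde]]]]|Htriv].
    - destruct (choice_of_blocks M_trans M_ZF S_in_M HPP Hd He Hde fun_S) as [c [Mc Hc]].
      + intros b n m Hb Hn Hm.
        (* The indices in [w1] of the three reals are the points whose stabilizers make the name
           symmetric. *)
        apply replP in Hb; destruct Hb as [b0 [Hb0 ->]].
        apply replP in Hd; destruct Hd as [d0 [Hd0 ->]].
        apply replP in He; destruct He as [e0 [He0 ->]].
        pose proof (proj1 w1_omega1) as Vw.
        destruct (check_exists V_trans V_ZF Vw) as [h [Vh Hh]].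
        exists (block_value G b0 d0 e0 n m); split.
        * exact (block_value_sequence V_trans V_ZF Vw G_generic Hb0 Hd0 He0 Vh Hh Hn Hm).
        * apply block_value_block with (w1 := w1); assumption.
      + exact (well_orderable_of_choice M_trans M_ZF S_in_M Mc Hc).
    - assert (Hsub : forall x y, x ∈ S -> y ∈ S -> x ⊆ y).
      { intros x y Hx Hy z Hz; pose proof (fun_S x Hx) as fx; pose proof (fun_S y Hy) as fy.
        pose proof (proj1 fx z Hz) as Hp; apply prodP in Hp.
        destruct Hp as [k [Hk [v [Hv ->]]]].
        replace v with (app y k); [exact (app_mem fy Hk)|].
        apply NNPP; intros H; apply Htriv; exists (app y k), v.
        split; [exact (app_in fy Hk)|auto]. }
      (* Any two members of [S] are equal in this case, so the empty relation well-orders [S]. *)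
      exists empty; split; [exact (class_empty M_trans M_ZF S_in_M)|].
      repeat split.
      + intros x _ H; destruct (emptyP H).
      + intros x y z _ _ _ H; destruct (emptyP H).
      + intros x y Hx Hy; right; left; apply subset_antisym; auto.
      + intros X _ HX HX0; destruct (proj1 (nonemptyP X) HX0) as [x Hx].
        exists x; split; [exact Hx|]; intros y Hy; left; apply subset_antisym; auto. }
  split; [exact WO|].
  intros HPP HSVC; exact (AC_of_SVC M_trans M_ZF S_in_M (WO HPP) HSVC).
Qed.
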